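(* Let $\ell=2$, $q$ odd, $4\mid q-\eta$, let $m\ge1$, $\alpha,\gamma\ge0$ and $\mathbf c\ne\mathbf 0$. Suppose the basic subgroup $\tilde R_{m,\alpha,\gamma,\mathbf c}$ is a radical $2$-subgroup of $\tilde G_{m,\alpha,\gamma,\mathbf c}=\mathrm{GL}_{m2^{\alpha+\gamma+|\mathbf c|}}(\eta q)$. Then $\tilde R_{m,\alpha,\gamma,\mathbf c}$ is special with respect to $G_{m,\alpha,\gamma,\mathbf c}=\mathrm{SL}_{m2^{\alpha+\gamma+|\mathbf c|}}(\eta q)$ unless $a=2$, $\alpha=\gamma=0$, $\nu(m)\le1$ and $\mathbf c=(1)$.
   Context: Let $p$ be an odd prime, $q$ a power of $p$, $\eta\in\{1,-1\}$ with $4\mid q-\eta$, $\overline{\mathbb F}$ an algebraic closure of $\mathbb F_q$. On $\mathrm{GL}_N(\overline{\mathbb F})$ let $F$ be $A\mapsto A^{(q)}$ (entrywise $q$-th powers) if $\eta=1$, and $A\mapsto((A^{(q)})^{-1})^t$ if $\eta=-1$. $\mathrm{GL}_N((\eta q)^k)$ denotes the fixed points of $F^k$; so $\mathrm{GL}_N(\eta q)$ is $\mathrm{GL}_N(q)$ or $\mathrm{GU}_N(q)$, and $\mathrm{SL}_N(\eta q)$ is its subgroup of determinant 1. $\nu$ is the $2$-adic valuation, $a=\nu(q-\eta)\ge2$. Tensor product of matrices: $A\otimes B=(b_{ij}A)$. Basic subgroups: fix $\zeta\in\overline{\mathbb F}^\times$ of order $2^{a+\alpha}$, $x=\mathrm{diag}(1,-1)$,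 $y=\begin{pmatrix}0&1\\ 1&0\end{pmatrix}$; for $1\le j\le\gamma$, $x_j$, $y_j$ are the $\gamma$-fold tensor products with $x$, resp. $y$, in position $j$ and $I_2$ elsewhere. Let $R^0=\langle \zeta I_{m2^\gamma},\,I_m\otimes x_j,\,I_m\otimes y_j: 1\le j\le\gamma\rangle\le\mathrm{GL}_{m2^\gamma}((\eta q)^{2^\alpha})$. Put $k=2^\alpha$, choose $g_1\in\mathrm{SL}_k(\overline{\mathbb F})$ with $g_1^{-1}F(g_1)=\begin{pmatrix}0&-1\\ I_{k-1}&0\end{pmatrix}$ if $k>1$ ($g_1=1$ if $k=1$), $g=I_{m2^\gamma}\otimes g_1$, and $\tilde R_{m,\alpha,\gamma}=\{g\,\mathrm{diag}(A,F(A),\dots,F^{k-1}(A))\,g^{-1}:A\in R^0\}\le\mathrm{GL}_{m2^{\alpha+\gamma}}(\eta q)$. For a finite sequence $\mathbf c=(c_1,\dots,c_r)$ of positive integers (the empty sequence is $\mathbf 0$), $|\mathbf c|=c_1+\cdots+c_r$, $A_{\mathbf c}=A_{c_1}\wr\cdots\wr A_{c_r}\le\mathfrak S_{2^{|\mathbf c|}}$, where $A_c$ is elementary abelian of order $2^c$ in its regular permutation representation, and $\tilde R_{m,\alpha,\gamma,\mathbf c}=\tilde R_{m,\alpha,\gamma}\wr A_{\mathbf c}\le\mathrm{GL}_{m2^{\alpha+\gamma+|\mathbf c|}}(\eta q)$ (monomial block matrices). A $2$-subgroup $\tilde R$ of a finite group $\tilde H$ is radical if $\tilde R=\mathrm O_2(N_{\tilde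 H}(\tilde R))$. If $H\unlhd\tilde H$, a radical $2$-subgroup $\tilde R$ of $\tilde H$ is special with respect to $H$ if $\tilde R=\mathrm O_2(N_{\tilde H}(\tilde R\cap H))$. *)

(* Defs.v *)
From HB Require Import structures.
From mathcomp Require Import all_boot all_order all_algebra all_fingroup.
From mathcomp Require Import all_solvable all_field.
From mathcomp.real_closed Require Import mxtens.

Set Implicit Arguments.
Unset Strict Implicit.
Unset Printing Implicit Defensive.

Import GRing.Theory.
Local Open Scope ring_scope.

Definition frobmx (K : fieldType) (q N : nat) (A : 'M[K]_N) : 'M[K]_N :=
  map_mx (fun x => x ^+ q) A.

(* For eta = -1 this is only meaningful on invertible matrices. *)
Definition steinberg (K : fieldType) (q : nat) (eta : int) {N : nat}
    (A : 'M[K]_N) : 'M[K]_N :=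
  if eta == 1 then frobmx q A else (invmx (frobmx q A))^T.

(* GL_N((eta q)^k) for k = 2 ^ e and q = #|Fq|, as a finite group of matrices
   over K; in particular e = 0 gives GL_N(eta q).  The embedding iota occurs in
   no field: it is a parameter because it forces the characteristic of K, which
   makes the q-th power map additive. *)
Record GLF (Fq : finFieldType) (K : closedFieldType)
    (iota : {rmorphism Fq -> K}) (eta : int) (e N : nat) : predArgType :=
  MkGLF {
    GLmx :> 'M[K]_N;
    _ : (GLmx \in unitmx) && (iter (2 ^ e) (steinberg #|Fq| eta) GLmx == GLmx)
  }.

HB.instance Definition _ (Fq : finFieldType) (K : closedFieldType)
    (iota : {rmorphism Fq -> K}) (eta : int) (e N : nat) :=
  [isSub for @GLmx Fq K iota eta e N].
HB.instance Definition _ (Fq : finFieldType) (K : closedFieldType)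
    (iota : {rmorphism Fq -> K}) (eta : int) (e N : nat) :=
  [Choice of GLF iota eta e N by <:].

Section Frobenius.

Context (Fq : finFieldType) (K : closedFieldType).

Definition frobq (iota : {rmorphism Fq -> K}) (x : K) : K := x ^+ #|Fq|.

Context (iota : {rmorphism Fq -> K}).

Fact frobq_zmod_morphism : {morph frobq iota : x y / x - y}.
Proof.
have [p pr_p chp] := finPcharP Fq.
have chK : p \in [pchar K] by rewrite (fmorph_pchar iota).
have pq : [pchar K].-nat #|Fq|.
  rewrite -cardsT; apply: sub_in_pnat (abelem_pgroup (fin_ring_pchar_abelem chp)).
  by move=> r _ /eqP->.
by move=> x y; rewrite /frobq exprDn_pchar // exprNn_pchar.
Qed.

Fact frobq_monoid_morphism : monoid_morphism (frobq iota).
Proof.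
by split=> [|x y]; rewrite /frobq ?expr1n // exprMn.
Qed.

HB.instance Definition _ :=
  GRing.isZmodMorphism.Build K K (frobq iota) frobq_zmod_morphism.
HB.instance Definition _ :=
  GRing.isMonoidMorphism.Build K K (frobq iota) frobq_monoid_morphism.

Context (eta : int) (N : nat).
Notation F := (@steinberg K #|Fq| eta N).
Implicit Types A B : 'M[K]_N.

Lemma frobmxE A : frobmx #|Fq| A = map_mx (frobq iota) A.
Proof. by []. Qed.

Lemma steinberg_unit A : (F A \in unitmx) = (A \in unitmx).
Proof.
rewrite /steinberg frobmxE; case: ifP => _; first by rewrite map_unitmx.
by rewrite unitmx_tr unitmx_inv map_unitmx.
Qed.

Lemma steinberg1 : F 1%:M = 1%:M.
Proof.
by rewrite /steinberg frobmxE map_mx1 invmx1 trmx1 if_same.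
Qed.

Lemma invmxM A B : A \in unitmx -> B \in unitmx ->
  invmx (A *m B) = invmx B *m invmx A.
Proof.
move=> uA uB; have uAB : A *m B \in unitmx by rewrite unitmx_mul uA.
apply: (can_inj (mulKmx uAB)); rewrite mulmxV // mulmxA mulmxK //.
by rewrite mulmxV.
Qed.

Lemma steinbergM A B : A \in unitmx -> B \in unitmx ->
  F (A *m B) = F A *m F B.
Proof.
move=> uA uB; rewrite /steinberg !frobmxE map_mxM; case: ifP => // _.
by rewrite invmxM ?map_unitmx // trmx_mul.
Qed.

Lemma steinbergV A : A \in unitmx -> F (invmx A) = invmx (F A).
Proof.
move=> uA; rewrite /steinberg !frobmxE map_invmx; case: ifP => // _.
by rewrite -trmx_inv.
Qed.

Lemma steinberg2 A : A \in unitmx -> F (F A) = map_mx (fun x => x ^+ (#|Fq| ^ 2)) A.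
Proof.
move=> uA.
have fr2 : map_mx (frobq iota) (map_mx (frobq iota) A)
   = map_mx (fun x => x ^+ (#|Fq| ^ 2)) A.
  by apply/matrixP => i j; rewrite !mxE /frobq exprM.
rewrite {1}/steinberg [F A]/steinberg !frobmxE.
case: (eta == 1); first exact: fr2.
by rewrite -map_trmx map_invmx trmx_inv trmxK invmxK.
Qed.

Lemma iter_steinberg_unit k A : (iter k F A \in unitmx) = (A \in unitmx).
Proof. by elim: k => //= k; rewrite steinberg_unit. Qed.

Lemma iter_steinberg1 k : iter k F 1%:M = 1%:M.
Proof. by elim: k => //= k ->; rewrite steinberg1. Qed.

Lemma iter_steinbergM k A B : A \in unitmx -> B \in unitmx ->
  iter k F (A *m B) = iter k F A *m iter k F B.
Proof.
move=> uA uB; elim: k => //= k ->.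
by rewrite steinbergM // iter_steinberg_unit.
Qed.

Lemma iter_steinbergV k A : A \in unitmx ->
  iter k F (invmx A) = invmx (iter k F A).
Proof.
move=> uA; elim: k => //= k ->.
by rewrite steinbergV // iter_steinberg_unit.
Qed.

Lemma iter_steinberg_double k A : A \in unitmx ->
  iter (k + k) F A = map_mx (fun x => x ^+ ((#|Fq| ^ 2) ^ k)) A.
Proof.
move=> uA; elim: k => [|k IHk].
  by apply/matrixP => i j; rewrite mxE expr1.
rewrite addnS addSn !iterS steinberg2 ?iter_steinberg_unit // IHk.
by apply/matrixP => i j; rewrite !mxE -exprM -expnSr.
Qed.

End Frobenius.

Section FiniteGroup.

Context (Fq : finFieldType) (K : closedFieldType) (iota : {rmorphism Fq -> K}).
Context (eta : int) (e N : nat).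
Notation G := (GLF iota eta e N).

Definition fix_exponent : nat := ((#|Fq| ^ 2) ^ 2 ^ e)%N.

Definition fix_roots : seq K :=
  sval (closed_field_poly_normal ('X^fix_exponent - 'X)).

Lemma fix_rootsP x : x ^+ fix_exponent = x -> x \in fix_roots.
Proof.
move=> xE; rewrite /fix_roots; case: closed_field_poly_normal => s /= defP.
have n_gt1 : (1 < fix_exponent)%N.
  have q_gt1 : (1 < #|Fq|)%N := finNzRing_gt1 Fq.
  have q2_gt1 : (1 < #|Fq| ^ 2)%N by rewrite -(expn0 #|Fq|) ltn_exp2l.
  by rewrite /fix_exponent -(expn0 (#|Fq| ^ 2)) ltn_exp2l ?expn_gt0.
have nzP : 'X^fix_exponent - 'X != 0 :> {poly K}.
  by rewrite -size_poly_gt0 size_polyDl size_polyXn // size_polyN size_polyX.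
have: root ('X^fix_exponent - 'X) x by rewrite rootE !hornerE xE subrr.
by rewrite defP rootZ ?lead_coef_eq0 // root_prod_XsubC.
Qed.

Lemma GLmx_unit (A : G) : (A : 'M[K]_N) \in unitmx.
Proof. by case/andP: (valP A). Qed.

Lemma GLmx_fixed (A : G) : iter (2 ^ e) (steinberg #|Fq| eta) A = A :> 'M[K]_N.
Proof. by apply/eqP; case/andP: (valP A). Qed.

Lemma GLmx_fix_roots (A : G) i j : (A : 'M[K]_N) i j \in fix_roots.
Proof.
apply: fix_rootsP; have := iter_steinberg_double iota eta (2 ^ e) (GLmx_unit A).
by rewrite iterD !GLmx_fixed => /matrixP/(_ i j); rewrite [RHS]mxE => <-.
Qed.

Definition GLF_code (A : G) : 'M[seq_sub fix_roots]_N :=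
  \matrix_(i, j) SeqSub (GLmx_fix_roots A i j).

Definition GLF_decode (B : 'M[seq_sub fix_roots]_N) : option G :=
  insub (map_mx val B).

Lemma GLF_codeK : pcancel GLF_code GLF_decode.
Proof.
move=> A; rewrite /GLF_decode.
have ->: map_mx val (GLF_code A) = A by apply/matrixP=> i j; rewrite !mxE.
by rewrite -[GLmx A]/(val A) valK.
Qed.

HB.instance Definition _ := Countable.copy G (pcan_type GLF_codeK).
HB.instance Definition _ : isFinite G := PCanIsFinite GLF_codeK.

Fact GLF_one_subproof : ((1%:M : 'M[K]_N) \in unitmx)
  && (iter (2 ^ e) (steinberg #|Fq| eta) (1%:M : 'M[K]_N) == 1%:M).
Proof. by rewrite unitmx1 (iter_steinberg1 iota) eqxx. Qed.

Fact GLF_mul_subproof (A B : G) : (A *m B \in unitmx)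
  && (iter (2 ^ e) (steinberg #|Fq| eta) (A *m B) == A *m B).
Proof.
by rewrite unitmx_mul !GLmx_unit (iter_steinbergM iota) ?GLmx_unit // !GLmx_fixed /=.
Qed.

Fact GLF_inv_subproof (A : G) : (invmx A \in unitmx)
  && (iter (2 ^ e) (steinberg #|Fq| eta) (invmx A) == invmx A).
Proof.
by rewrite unitmx_inv GLmx_unit (iter_steinbergV iota) ?GLmx_unit // GLmx_fixed /=.
Qed.

Definition GLF_one : G := MkGLF iota GLF_one_subproof.
Definition GLF_mul (A B : G) : G := MkGLF iota (GLF_mul_subproof A B).
Definition GLF_inv (A : G) : G := MkGLF iota (GLF_inv_subproof A).

Fact GLF_mulA : associative GLF_mul.
Proof. by move=> A B C; apply: val_inj; rewrite /= mulmxA. Qed.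

Fact GLF_mul1 : left_id GLF_one GLF_mul.
Proof. by move=> A; apply: val_inj; rewrite /= mul1mx. Qed.

Fact GLF_mulV : left_inverse GLF_one GLF_inv GLF_mul.
Proof. by move=> A; apply: val_inj; rewrite /= mulVmx ?GLmx_unit. Qed.

HB.instance Definition _ :=
  Finite_isGroup.Build G GLF_mulA GLF_mul1 GLF_mulV.

Definition SLF : {set G} := [set A : G | \det A == 1].

Lemma SLF_group_set : group_set SLF.
Proof.
apply/group_setP; split=> [|A B]; rewrite !inE; first by rewrite det1.
by move=> /eqP dA /eqP dB; rewrite det_mulmx dA dB mulr1.
Qed.

Canonical SLF_group := Group SLF_group_set.

Lemma SLF_normal : (SLF <| [set: G])%g.
Proof.
apply/normalP; split=> [|B _]; first exact: subsetT.
apply/setP => A; rewrite mem_conjg !inE /= invmxK !det_mulmx det_inv mulrCA.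
by rewrite divff ?mulr1 // -unitfE -unitmxE GLmx_unit.
Qed.

End FiniteGroup.

(* The r * n square matrix with r * r blocks of size n, the (u, v)-th block
   being B u v. *)
Definition blockmx (R : Type) (r n : nat) (B : 'I_r -> 'I_r -> 'M[R]_n) :
    'M[R]_(r * n) :=
  \matrix_(i, j) B (mxtens_unindex i).1 (mxtens_unindex j).1
                   (mxtens_unindex i).2 (mxtens_unindex j).2.

(* A (x) B is the block matrix (b_ij A), hence the swap: tensmx M N has blocks
   m_ij N. *)
Definition tens (R : pzRingType) (m n : nat) (A : 'M[R]_m) (B : 'M[R]_n) :
    'M[R]_(n * m) :=
  tensmx B A.

(* M 0 (x) M 1 (x) ... (x) M (n - 1) *)
Fixpoint tens_pow (R : pzRingType) (n : nat) (M : nat -> 'M[R]_2) :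
    'M[R]_(2 ^ n) :=
  if n is n'.+1 return 'M[R]_(2 ^ n)
  then castmx (esym (expnS 2 n'), esym (expnS 2 n')) (tens (tens_pow n' M) (M n'))
  else 1%:M.

Definition mx_x (R : pzRingType) : 'M[R]_2 := diag_mx (\row_(i < 2) (-1) ^+ i).
Definition mx_y (R : pzRingType) : 'M[R]_2 := \matrix_(i, j) (i != j)%:R.

(* The index j counts tensor positions from 0. *)
Definition mx_xj (R : pzRingType) (gamma j : nat) : 'M[R]_(2 ^ gamma) :=
  tens_pow gamma (fun i => if i == j then mx_x R else 1%:M).
Definition mx_yj (R : pzRingType) (gamma j : nat) : 'M[R]_(2 ^ gamma) :=
  tens_pow gamma (fun i => if i == j then mx_y R else 1%:M).

(* The block matrix (0, -1; I_{k-1}, 0). *)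
Definition lang_mx (R : pzRingType) (k : nat) : 'M[R]_k :=
  \matrix_(i, j) (if i == j.+1 :> nat then 1
                  else if (i == 0 :> nat) && (j == k.-1 :> nat) then -1 else 0).

Definition lang_elt (K : fieldType) (q : nat) (eta : int) (k : nat)
    (g1 : 'M[K]_k) : Prop :=
  [/\ \det g1 = 1,
      (k = 1)%N -> g1 = 1%:M
    & (1 < k)%N -> invmx g1 *m steinberg q eta g1 = lang_mx K k].

Section BasicSubgroups.

Context (Fq : finFieldType) (K : closedFieldType) (iota : {rmorphism Fq -> K}).
Context (eta : int) (m alpha gamma : nat).

(* The generators zeta I, I_m (x) x_j, I_m (x) y_j; they are all fixed by F^k,
   k = 2 ^ alpha, when zeta has order 2 ^ (a + alpha). *)
Definition basic0_gens (zeta : K) : {set GLF iota eta alpha (2 ^ gamma * m)} :=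
  [set A : GLF iota eta alpha (2 ^ gamma * m) |
    (GLmx A == zeta%:M)
    || [exists j : 'I_gamma, (GLmx A == tens 1%:M (mx_xj K gamma j))
                           || (GLmx A == tens 1%:M (mx_yj K gamma j))]].

Definition basic0 (zeta : K) : {set GLF iota eta alpha (2 ^ gamma * m)} :=
  <<basic0_gens zeta>>%g.

(* g diag(A, F A, ..., F^(k-1) A) g^-1 with k = 2 ^ alpha and g = I (x) g1.  It
   is fixed by F when A is fixed by F^k and lang_elt holds of g1, so that the
   set basic below consists of all these matrices. *)
Definition twist_mx (g1 : 'M[K]_(2 ^ alpha)) (A : 'M[K]_(2 ^ gamma * m)) :
    'M[K]_(2 ^ alpha * (2 ^ gamma * m)) :=
  let g := tens 1%:M g1 in
  g *m blockmx (fun u v => if u == v then iter u (steinberg #|Fq| eta) A else 0)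
    *m invmx g.

Definition basic (zeta : K) (g1 : 'M[K]_(2 ^ alpha)) :
    {set GLF iota eta 0 (2 ^ alpha * (2 ^ gamma * m))} :=
  [set X : GLF iota eta 0 (2 ^ alpha * (2 ^ gamma * m)) |
    [exists A in basic0 zeta, GLmx X == twist_mx g1 (GLmx A)]].

End BasicSubgroups.

(* The imprimitive wreath product A wr B, acting on r blocks of size n. *)
Definition perm_wreath (n r : nat) (A : {set 'S_n}) (B : {set 'S_r}) :
    {set 'S_(r * n)} :=
  [set s : 'S_(r * n) |
    [exists b in B, exists f : {ffun 'I_r -> 'S_n},
      [forall u, f u \in A] &&
      [forall u, forall i,
        s (mxtens_index (u, i)) == mxtens_index (b u, f u i)]]].

Fact iter_wreath_subproof (d : nat) (c : seq nat) :
  (2 ^ sumn c * 2 ^ d = 2 ^ sumn (d :: c))%N.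
Proof. by rewrite /= expnD mulnC. Qed.

(* A_{c_1} wr A_{c_2} wr ... wr A_{c_r}, with c_1 the innermost factor. *)
Fixpoint iter_wreath (A : forall d, {set 'S_(2 ^ d)}) (c : seq nat) :
    {set 'S_(2 ^ sumn c)} :=
  if c is d :: c' return {set 'S_(2 ^ sumn c)}
  then cast_perm (iter_wreath_subproof d c') @: perm_wreath (A d) (iter_wreath A c')
  else [set: 'S_(2 ^ 0)].

(* The regular permutation representation is determined up to relabelling of the
   points; this predicate leaves the labelling free. *)
Definition regular_abelem (d : nat) (A : {group 'S_(2 ^ d)}) : Prop :=
  [/\ (2.-abelem A)%g, #|A| = (2 ^ d)%N, [transitive A, on [set: 'I_(2 ^ d)] | 'P]%g
    & forall i : 'I_(2 ^ d), 'C_A[i | 'P]%g = 1%g].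

(* R wr B as a set of monomial block matrices. *)
Definition mx_wreath (Fq : finFieldType) (K : closedFieldType)
    (iota : {rmorphism Fq -> K}) (eta : int) (n r : nat)
    (R : {set GLF iota eta 0 n}) (B : {set 'S_r}) :
    {set GLF iota eta 0 (r * n)} :=
  [set X : GLF iota eta 0 (r * n) |
    [exists b in B, exists f : {ffun 'I_r -> GLF iota eta 0 n},
      [forall u, f u \in R] &&
      (GLmx X == blockmx (fun u v => if v == b u then GLmx (f u) else 0))]].

(* The factors are in the order that makes the block structures definitional;
   the number is m * 2 ^ (alpha + gamma + |c|). *)
Definition basic_dim (m alpha gamma : nat) (c : seq nat) : nat :=
  (2 ^ sumn c * (2 ^ alpha * (2 ^ gamma * m)))%N.

Lemma basic_dimE (m alpha gamma : nat) (c : seq nat) :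
  basic_dim m alpha gamma c = (m * 2 ^ (alpha + gamma + sumn c))%N.
Proof. by rewrite /basic_dim mulnC [(2 ^ alpha * _)%N]mulnA [(_ * m)%N]mulnC -mulnA !expnD. Qed.

Definition basic_subgroup (Fq : finFieldType) (K : closedFieldType)
    (iota : {rmorphism Fq -> K}) (eta : int) (zeta : K)
    (A : forall d, {group 'S_(2 ^ d)}) (m alpha gamma : nat) (c : seq nat)
    (g1 : 'M[K]_(2 ^ alpha)) : {set GLF iota eta 0 (basic_dim m alpha gamma c)} :=
  mx_wreath (basic iota eta m gamma zeta g1) (iter_wreath A c).

Definition radical2 (gT : finGroupType) (H R : {set gT}) : Prop :=
  [/\ group_set R, R \subset H, (2.-group R)%g & R = 'O_2('N_H(R))%g].

Definition special2 (gT : finGroupType) (Ht H R : {set gT}) : Prop :=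
  radical2 Ht R /\ R = 'O_2('N_Ht(R :&: H))%g.

(* Main.v *)
Require Import Defs.
From mathcomp Require Import all_boot all_order all_algebra all_fingroup.
From mathcomp Require Import all_solvable all_field.
From mathcomp.real_closed Require Import mxtens.

Set Implicit Arguments.
Unset Strict Implicit.
Unset Printing Implicit Defensive.

Import GRing.Theory.
Local Open Scope ring_scope.

(** Write the basic subgroup as $\tilde R = B \wr P$, a group of monomial
    matrices with $t \ge 2$ blocks and base group $D = B^t$.  Put
    $R = \tilde R \cap SL$, $D_0 = D \cap SL$ and $N = N(R)$.

    Normalizers grow in 2-groups, so it suffices to show $\tilde R \le O_2(N)$
    ([radical2_special2]).  As $-1 \in B$, the elements of $D$ supported on one
    block take every value of the determinant on block permutations; hence
    $\tilde R = D R$ ([mx_wreath_mulS]).  Since $R$ is a normal 2-subgroup of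
    $N$, only $D \le O_2(N)$ is at stake.

    The group $B$ has class at most 2, so $D$ stabilizes the chain
    $R > D_0 > Z(D_0) > 1$.  Moreover $B$ contains the scalar $i$ with
    $i^2 = -1$, and the elements of $D_0$ equal to $i$ on one block and $-i$ on
    another force a matrix commuting with $D_0$ to be block diagonal, whence
    $C(D_0) = C(D)$ ([cent_base_SLF]).  If $N$ normalizes $D_0$, then the normal
    closure of $D$ in $N$ has the same two properties; by coprime action its
    elements of odd order centralize $R$, so they are central in it, it is
    nilpotent, and $D \le O_2(N)$ ([stabilizer_sub_pcore]).

    The heart of the matter is therefore that $N$ normalizes $D_0$.  This holds
    because $D_0$ is generated by the elements of $R$ whose $R$-conjugates all
    commute, a set that $N$ preserves.  Elements of $D_0$ of the form $b$ on one
    block, $b^{-1}$ on another, belong to it because $B$ has class 2, and so do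
    those supported on one block; they generate $D_0$ ([base_SLF_sub_gen]).
    Conversely let $r$ in this set permute the blocks nontrivially.  Its
    commutators with the elements of $D_0$ commute with $r$ and with one
    another, which is impossible
    - if there are at least four blocks ([fix_of_four_blocks]);
    - if there are two blocks and $J^4 \ne 1$ for some $J \in Z(B)$
      ([fix_of_central]);
    - if $B$ has two noncommuting elements that are commutators of invertible
      matrices over $K$, hence have determinant 1 ([fix_of_noncommuting]).

    There are at least four blocks unless $\mathbf c = (1)$.  If $\gamma > 0$,
    the matrices $i x_1$ and $i y_1$ do not commute and are commutators, for
    instance $i x_1 = [y_1, 1 - i x_1]$ ([mx_commutator_involutions]).  If
    $a + \alpha \ge 3$, the twist of $\zeta$ is a central $J$ as required.
    Otherwise $a = 2$, $\alpha = \gamma = 0$ and $B$ consists of scalars of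
    order dividing 4.  Outside the exceptional case 4 divides $m$, all
    determinants are 1, and $R = \tilde R$. *)

(** * Special radical subgroups and stabilizers of chains *)

Section Radical.

Local Open Scope group_scope.

Context (gT : finGroupType).
Implicit Types D H N R : {group gT}.

(** With $Q = O_2(N(R \cap H))$, the group $N_Q(R)$ is a normal 2-subgroup of
    $N(R)$, because $N(R) \le N(R \cap H)$; by radicality it lies in $R$, and a
    proper subgroup of the nilpotent group $Q$ cannot be self-normalizing. *)
Lemma radical2_special2 H R : H <| [set: gT] -> radical2 [set: gT] R ->
  R \subset 'O_2('N_[set: gT](R :&: H)) -> special2 [set: gT] H R.
Proof.
move=> /andP[_ nH] radR sRQ; split=> //.
have [_ _ _ defR] := radR; move: defR sRQ; rewrite !setTI => defR.
set Q := 'O_2(_) => sRQ.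
have sNN : 'N(R) \subset 'N(R :&: H).
  by rewrite normsI ?normG // (subset_trans _ nH) ?subsetT.
suff defQ : Q :=: R by rewrite -[LHS]defQ.
apply: (nilpotent_sub_norm (pgroup_nil (pcore_pgroup _ _))) => //.
have: 'N_Q(R) \subset 'O_2('N(R)).
  rewrite pcore_max ?(pgroupS (subsetIl _ _) (pcore_pgroup _ _)) //.
  rewrite /normal subsetIr normsI ?normG //.
  by rewrite (subset_trans sNN) ?gFnorm.
by rewrite -defR.
Qed.

Lemma commg_normal_closure (D0 : {group gT}) D N R :
    N \subset 'N(R) -> N \subset 'N(D0) -> D \subset N ->
    R \subset 'N(D0) -> [~: R, D] \subset D0 ->
  [~: R, <<class_support D N>>] \subset D0.
Proof.
move=> nRN nDN sDN nDR sRD.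
have sLN : class_support D N \subset N by rewrite class_support_subG.
rewrite -quotient_cents2 ?gen_subG ?(subset_trans sLN) // centsC.
rewrite quotient_gen ?(subset_trans sLN) // gen_subG class_supportEr centsC.
rewrite quotient_cents2 //; last by rewrite -class_supportEr (subset_trans sLN).
rewrite commGC gen_subG.
apply/subsetP=> _ /imset2P[y r /bigcupP[x Nx]] Dy Rr ->.
rewrite -groupV invg_comm -(normsP nDN x Nx).
have Rx : R :^ x = R by apply: (normsP nRN).
rewrite -Rx in Rr; apply: (subsetP _ _ (mem_commg Rr Dy)).
by rewrite -conjsRg conjSg.
Qed.

(** If $x^y = xz$ and $z$ commutes with $y$, then $x^{y^k} = x z^k$, so the
    order of $z$ divides that of $y$; this is the elementwise form of coprime
    action on a chain. *)
Lemma conjg_fix_coprime (x y z : gT) :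
  x ^ y = x * z -> commute z y -> 2.-elt z -> odd #[y] -> x ^ y = x.
Proof.
move=> xy czy z2 oddy.
have xyk k : x ^ (y ^+ k) = x * z ^+ k.
  elim: k => [|k IHk]; first by rewrite conjg1 mulg1.
  rewrite expgSr conjgM IHk conjMg xy conjXg (conjgE z) czy mulKg.
  by rewrite -mulgA expgS.
have zy1 : z ^+ #[y] = 1.
  by apply: (mulgI x); rewrite mulg1 -xyk expg_order conjg1.
suff z1 : z = 1 by rewrite xy z1 mulg1.
apply/eqP; rewrite -order_eq1 -dvdn1.
have <-: gcdn #[z] #[y] = 1%N.
  by apply/eqP; rewrite -/(coprime _ _) (pnat_coprime z2) // -odd_2'nat.
by rewrite dvdn_gcd dvdnn order_dvdn zy1 eqxx.
Qed.

(** The normal closure $L$ of $D$ in $N$ inherits from $D$ the stabilization of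
    the chain $R \ge D_0 \ge Z(D_0) \ge 1$ and the trivial action on $C_N(D_0)$.
    An element of $L$ of odd order therefore centralizes $R$; being in $C_N(D_0)$
    it commutes with $L$.  Thus $L/Z(L)$ is a 2-group and $L$ is nilpotent. *)
Lemma stabilizer_sub_pcore (D0 : {group gT}) D N R :
    R \subset N -> N \subset 'N(R) -> D0 \subset R -> N \subset 'N(D0) ->
    D \subset N -> 2.-group D -> 2.-group R ->
    [~: R, D] \subset D0 -> [~: D0, D] \subset 'Z(D0) ->
    D \subset 'C('C_N(D0)) ->
  D \subset 'O_2(N).
Proof.
move=> sRN nRN sD0R nDN sDN pD pR sRD sDD cCD.
pose L := <<class_support D N>>.
have sLN : L \subset N by rewrite gen_subG class_support_subG.
have sDL : D \subset L.
  rewrite sub_gen // class_supportEr; apply: (bigcup_max 1%g) => //.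
  by rewrite conjsg1.
have nLN : N \subset 'N(L) by rewrite norms_gen ?class_support_norm.
have nCN : N \subset 'N('C_N(D0)) by rewrite normsI ?normG ?norms_cent.
have cCL : L \subset 'C('C_N(D0)).
  by rewrite gen_subG class_support_sub_norm ?norms_cent.
have sRL : [~: R, L] \subset D0.
  by rewrite commg_normal_closure // (subset_trans sRN).
have nZN : N \subset 'N('Z(D0)) by rewrite (gFnorm_trans _ nDN).
have sDL' : [~: D0, L] \subset 'Z(D0).
  by rewrite commg_normal_closure // (subset_trans sD0R) ?(subset_trans sRN).
have sZC : 'Z(D0) \subset 'C_N(D0).
  by rewrite subsetI subsetIr andbT gFsub_trans // (subset_trans sD0R).
have oddZ y : y \in L -> odd #[y] -> y \in 'Z(L).
  move=> Ly oddy; apply/setIP; split=> //.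
  have p2 z : z \in R -> 2.-elt z by apply: mem_p_elt pR.
  have fixD d : d \in D0 -> d ^ y = d.
    move=> Dd; have zZ : [~ d, y] \in 'Z(D0).
      by rewrite (subsetP sDL') ?mem_commg.
    apply: (@conjg_fix_coprime _ _ [~ d, y]) => //.
    - by rewrite commgEl mulKVg.
    - have /centP := subsetP cCL y Ly; move/(_ _ (subsetP sZC _ zZ)) => cyz.
      by apply: commute_sym.
    - by apply/p2/(subsetP sD0R)/(subsetP (center_sub D0)).
  have fixR r : r \in R -> r ^ y = r.
    move=> Rr; have zD : [~ r, y] \in D0 by rewrite (subsetP sRL) ?mem_commg.
    apply: (@conjg_fix_coprime _ _ [~ r, y]) => //.
    - by rewrite commgEl mulKVg.
    - by apply/commgP/conjg_fixP/fixD.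
    - by apply/p2/(subsetP sD0R).
  suff: y \in 'C_N(D0) by apply: (subsetP _); rewrite centsC.
  rewrite inE (subsetP sLN) //=; apply/centP=> d Dd.
  by apply/commute_sym/commgP/conjg_fixP/fixD.
have nilL : nilpotent L.
  rewrite -quotient_center_nil (pgroup_nil (p := 2)) // /pgroup.
  apply/pnatP=> // r r_pr /Cauchy[] // xb /morphimP[x _ Lx ->] ox.
  apply: contraTT isT => r2; have := ox.
  have oddr : odd r by case: (even_prime r_pr) r2 => [-> | ->].
  have Zx : x.`_(2%N)^' \in 'Z(L).
    by rewrite oddZ ?groupX // odd_2'nat; apply: p_elt_constt.
  have nx : x \in 'N('Z(L)).
    by rewrite (subsetP (normal_norm (center_normal L))).
  have cE : coset 'Z(L) x = coset 'Z(L) x.`_2%N.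
    rewrite -{1}(consttC 2%N x) morphM ?groupX //=.
    by rewrite (coset_id Zx) mulg1.
  have x2 : 2.-elt (coset 'Z(L) x).
    by rewrite cE morph_p_elt ?groupX ?p_elt_constt.
  by move=> _; move: x2; rewrite /p_elt ox pnatE // (negPf r2).
have sDO : D \subset 'O_2(L).
  by rewrite (sub_Hall_pcore (nilpotent_pcore_Hall 2%N nilL)).
rewrite (subset_trans sDO) // pcore_max ?pcore_pgroup ?gFnormal_trans //.
by rewrite /normal sLN.
Qed.

End Radical.

Section AbelianClasses.

Local Open Scope group_scope.

Context (gT : finGroupType).
Implicit Types R : {group gT}.

(** Equivalently, the elements of a group whose normal closure in it is abelian:
    these generate a subgroup that depends on the group alone. *)
Definition abelian_classes (A : {set gT}) := [set r in A | abelian (r ^: A)].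

Lemma abelian_classesP R r :
  reflect (r \in R /\ forall x, x \in R -> commute r (r ^ x))
          (r \in abelian_classes R).
Proof.
rewrite inE; apply: (iffP andP) => [[Rr /centsP cRr] | [Rr cRr]]; split=> //.
  by move=> x Rx; apply: cRr; rewrite ?class_refl ?memJ_class.
apply/centsP=> _ /imsetP[x Rx ->] _ /imsetP[y Ry ->]; apply: (conjg_inj x^-1).
rewrite /= 2!(conjMg (_ ^ _)) -!conjgM mulgV conjg1.
by rewrite cRr ?groupM ?groupV.
Qed.

Lemma norm_abelian_classes R : 'N(R) \subset 'N(<<abelian_classes R>>).
Proof.
apply/norms_gen/subsetP=> x nRx; rewrite inE.
apply/subsetP=> _ /imsetP[r /abelian_classesP[Rr cRr] ->].
apply/abelian_classesP; split=> [|y Ry]; first by rewrite memJ_norm.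
have Ryx : y ^ x^-1 \in R by rewrite memJ_norm ?groupV.
have /(congr1 (conjg^~ x)) := cRr _ Ryx.
by rewrite /= (conjMg r) (conjMg (r ^ _)) -!conjgM -conjgCV.
Qed.

Lemma abelian_classes_commg R r x y : r \in abelian_classes R ->
  x \in R -> y \in R -> commute [~ r, x] [~ r, y].
Proof.
rewrite inE => /andP[Rr cRr] Rx Ry.
have clR z : z \in R -> [~ r, z] \in <<r ^: R>>.
  by move=> Rz; rewrite commgEl groupM ?groupV ?mem_gen ?class_refl ?memJ_class.
apply: (centsP _ _ (clR x Rx) _ (clR y Ry)).
by rewrite -/(abelian _) abelian_gen.
Qed.

End AbelianClasses.

(** * Monomial block matrices *)

Lemma big_mxtens_index (V : Type) (x0 : V) (op : Monoid.com_law x0)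
    t n (F : 'I_(t * n) -> V) :
  \big[op/x0]_k F k = \big[op/x0]_u \big[op/x0]_i F (mxtens_index (u, i)).
Proof.
rewrite pair_bigA (reindex (@mxtens_index t n)) /=.
  by apply: eq_bigr => -[].
by exists (@mxtens_unindex t n) => k _;
  rewrite (mxtens_indexK, mxtens_unindexK).
Qed.

Lemma scalar_mxI (V : pzRingType) n : (0 < n)%N ->
  injective (fun x : V => x%:M : 'M_n).
Proof.
case: n => // n _ x y /(congr1 (fun A : 'M_n.+1 => A ord0 ord0)).
by rewrite !mxE eqxx !mulr1n.
Qed.

Section BlockMatrices.

Context (K : fieldType) (t n : nat).
Implicit Types (A : 'M[K]_(t * n)) (B : 'I_t -> 'I_t -> 'M[K]_n).
Implicit Types (b : 'S_t) (f : 'I_t -> 'M[K]_n).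

Definition mxblk A (u v : 'I_t) : 'M[K]_n :=
  \matrix_(i, j) A (mxtens_index (u, i)) (mxtens_index (v, j)).

Lemma mxblkP A1 A2 : (forall u v, mxblk A1 u v = mxblk A2 u v) -> A1 = A2.
Proof.
move=> eqA; apply/matrixP=> k l.
case: (mxtens_indexP k) => u i; case: (mxtens_indexP l) => v j.
by have /matrixP/(_ i j) := eqA u v; rewrite !mxE.
Qed.

Lemma blockmxK B u v : mxblk (blockmx B) u v = B u v.
Proof. by apply/matrixP=> i j; rewrite !mxE !mxtens_indexK. Qed.

Lemma mxblkM A1 A2 u v :
  mxblk (A1 *m A2) u v = \sum_w mxblk A1 u w *m mxblk A2 w v.
Proof.
apply/matrixP=> i j; rewrite !mxE big_mxtens_index summxE.
by apply: eq_bigr => w _; rewrite mxE; apply: eq_bigr => k _; rewrite !mxE.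
Qed.

Lemma mxblk_scalar a u v : mxblk a%:M u v = if v == u then a%:M else 0.
Proof.
apply/matrixP=> i j; rewrite !mxE (can_eq (@mxtens_indexK _ _)) xpair_eqE.
by rewrite [v == u]eq_sym; case: eqP; rewrite !mxE ?mulr0n.
Qed.

Lemma mxblkD A1 A2 u v : mxblk (A1 + A2) u v = mxblk A1 u v + mxblk A2 u v.
Proof. by apply/matrixP=> i j; rewrite !mxE. Qed.

Lemma mxblkT A u v : mxblk A^T u v = (mxblk A v u)^T.
Proof. by apply/matrixP=> i j; rewrite !mxE. Qed.

Lemma mxblk_map (g : K -> K) A u v :
  mxblk (map_mx g A) u v = map_mx g (mxblk A u v).
Proof. by apply/matrixP=> i j; rewrite !mxE. Qed.

Definition monmx b f : 'M[K]_(t * n) :=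
  blockmx (fun u v => if v == b u then f u else 0).

Lemma monmxK b f u v : mxblk (monmx b f) u v = if v == b u then f u else 0.
Proof. by rewrite blockmxK. Qed.

Lemma eq_monmx b f1 f2 : f1 =1 f2 -> monmx b f1 = monmx b f2.
Proof. by move=> eqf; apply: mxblkP => u v; rewrite !monmxK eqf. Qed.

Lemma mxblk_monl A b f u v :
  mxblk (monmx b f *m A) u v = f u *m mxblk A (b u) v.
Proof.
rewrite mxblkM (bigD1 (b u)) //= monmxK eqxx big1 ?addr0 // => w /negPf nbw.
by rewrite monmxK nbw mul0mx.
Qed.

Lemma mxblk_monr A b f u v :
  mxblk (A *m monmx b f) u (b v) = mxblk A u v *m f v.
Proof.
rewrite mxblkM (bigD1 v) //= monmxK eqxx big1 ?addr0 // => w /negPf nbw.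
by rewrite monmxK (inj_eq perm_inj) eq_sym nbw mulmx0.
Qed.

Lemma monmxM b1 b2 f1 f2 :
  monmx b1 f1 *m monmx b2 f2 = monmx (b1 * b2)%g (fun u => f1 u *m f2 (b1 u)).
Proof.
apply: mxblkP => u v; rewrite mxblk_monl !monmxK permM.
by case: eqP => // _; rewrite mulmx0.
Qed.

Lemma monmx1 : monmx 1%g (fun _ => 1%:M) = 1%:M.
Proof. by apply: mxblkP => u v; rewrite monmxK mxblk_scalar perm1. Qed.

Lemma monmx_unit b f : (forall u, f u \in unitmx) -> monmx b f \in unitmx.
Proof.
move=> uf.
have: monmx b f *m monmx b^-1%g (fun u => invmx (f ((b^-1)%g u))) = 1%:M.
  rewrite monmxM mulgV -monmx1; apply: eq_monmx => u.
  by rewrite permK mulmxV.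
by case/mulmx1_unit.
Qed.

Lemma trmx_monmx b f :
  (monmx b f)^T = monmx b^-1%g (fun u => (f ((b^-1)%g u))^T).
Proof.
apply: mxblkP => u v; rewrite mxblkT !monmxK [u == _]eq_sym (canF_eq (permK b)).
have [-> // | _] := eqVneq v; exact: trmx0.
Qed.

Lemma map_monmx (g : {additive K -> K}) b f :
  map_mx g (monmx b f) = monmx b (fun u => map_mx g (f u)).
Proof.
apply: mxblkP => u v; rewrite mxblk_map !monmxK.
by case: eqP => // _; rewrite map_mx0.
Qed.

Lemma invmx_monmx b f : (forall u, f u \in unitmx) ->
  invmx (monmx b f) = monmx b^-1%g (fun u => invmx (f ((b^-1)%g u))).
Proof.
move=> uf; apply: (can_inj (mulKmx (monmx_unit b uf))).
rewrite mulmxV ?monmx_unit // monmxM mulgV -monmx1; apply: eq_monmx => u.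
by rewrite permK mulmxV.
Qed.

Lemma det_scalar_blocks (d : 'I_t -> K) :
  \det (monmx 1%g (fun u => (d u)%:M)) = \prod_u d u ^+ n.
Proof.
have ->: monmx 1%g (fun u => (d u)%:M)
    = diag_mx (\row_k d (mxtens_unindex k).1) :> 'M[K]_(t * n).
  apply: mxblkP => u v; rewrite monmxK perm1; apply/matrixP=> i j.
  rewrite !mxE mxtens_indexK (can_eq (@mxtens_indexK _ _)) xpair_eqE /=.
  by rewrite [v == u]eq_sym; case: eqP; rewrite !mxE ?mulr0n.
rewrite det_diag big_mxtens_index; apply: eq_bigr => u _.
under eq_bigr do rewrite mxE mxtens_indexK /=.
by rewrite prodr_const card_ord.
Qed.

(** The block transposition $T$ is conjugate to the involution $E$ that is $-1$
    on the block $v$ and $1$ elsewhere: $T(T + E) = (T + E)E$, and $T + E$ is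
    invertible because its square is diagonal with entries 2 and 4. *)
Lemma det_tperm_blocks (u v : 'I_t) : (2%:R : K) != 0 -> u != v ->
  \det (monmx (tperm u v) (fun _ => 1%:M)) = (-1) ^+ n.
Proof.
move=> nz2 neq_uv; set s := tperm u v; set T := monmx s _.
pose e w : K := if w == v then -1 else 1.
pose E : 'M[K]_(t * n) := monmx 1%g (fun w => (e w)%:M).
have detE : \det E = (-1) ^+ n.
  rewrite det_scalar_blocks (bigD1 v) //= big1 ?mulr1 /e ?eqxx // => w /negPf->.
  exact: expr1n.
have TT : T *m T = 1%:M.
  by rewrite monmxM tperm2 -monmx1; apply: eq_monmx => w; rewrite mulmx1.
have EE : E *m E = 1%:M.
  rewrite monmxM mulg1 -monmx1; apply: eq_monmx => w.
  by rewrite perm1 -scalar_mxM /e; case: ifP; rewrite ?mulrNN mulr1.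
pose h w : K := if (w == u) || (w == v) then 2%:R else 4%:R.
have PP : (T + E) *m (T + E) = monmx 1%g (fun w => (h w)%:M).
  rewrite mulmxDl !mulmxDr TT EE /E !monmxM mulg1 mul1g.
  apply: mxblkP => w1 w2; rewrite !mxblkD !mxblk_scalar !monmxK /= perm1.
  rewrite mul1mx mulmx1 [_ + (if w2 == w1 then _ else _)]addrC addrACA.
  have -> : (if w2 == s w1 then (e (s w1))%:M else 0)
      + (if w2 == s w1 then (e w1)%:M else 0)
      = if w2 == s w1 then (e (s w1) + e w1)%:M else 0 :> 'M[K]_n.
    by case: ifP => _; rewrite ?addr0 // -raddfD.
  have two : 1%:M + 1%:M = 2%:R%:M :> 'M[K]_n by rewrite -raddfD.
  rewrite /h /e; have [-> | neq_u] := eqVneq w1 u.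
    rewrite tpermL eqxx (negPf neq_uv) addNr raddf0 if_same addr0.
    by case: ifP; rewrite ?addr0 ?two.
  have [-> | neq_v] := eqVneq w1 v.
    rewrite tpermR (negPf neq_uv) subrr raddf0 if_same addr0.
    by case: ifP; rewrite ?addr0 ?two.
  rewrite tpermD 1?eq_sym // (negPf neq_v).
  by case: ifP; rewrite ?addr0 // -!raddfD /= -(natrD _ 2 2).
have uP : T + E \in unitmx.
  suff: (T + E) *m (T + E) \in unitmx by rewrite unitmx_mul andbb.
  rewrite PP monmx_unit // => w; rewrite unitmxE det_scalar unitfE expf_neq0 //.
  rewrite /h; case: ifP => // _.
  by rewrite (natrM _ 2 2) mulf_neq0.
have TP : T *m (T + E) = (T + E) *m E by rewrite mulmxDl mulmxDr TT EE addrC.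
have := congr1 determinant TP; rewrite !det_mulmx detE mulrC => /mulfI; apply.
by rewrite -unitfE -unitmxE.
Qed.

Lemma det_perm_blocks (s : 'S_t) : (2%:R : K) != 0 ->
  \det (monmx s (fun _ => 1%:M)) = ((-1) ^+ s) ^+ n.
Proof.
move=> nz2; have [ts -> dts] := prod_tpermP s.
rewrite odd_perm_prod // signr_odd.
elim: ts dts => [|[u v] ts IHts] /=.
  by rewrite big_nil monmx1 det1 expr1n.
case/andP=> neq_uv /IHts{}IHts; rewrite big_cons exprS exprMn -IHts.
rewrite -(det_tperm_blocks nz2 neq_uv) -det_mulmx monmxM.
by congr (\det _); apply: eq_monmx => w; rewrite mulmx1.
Qed.

End BlockMatrices.

(** The factors range over invertible matrices over $K$ that need not be fixed by
    the Frobenius map: this forces determinant 1, also after block extension and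
    twisting, with no computation of determinants. *)
Definition mx_commutator (K : fieldType) n (B : 'M[K]_n) : Prop :=
  exists g h, [/\ g \in unitmx, h \in unitmx & B *m (h *m g) = g *m h].

Lemma steinberg_monmx (Fq : finFieldType) (K : closedFieldType)
    (iota : {rmorphism Fq -> K}) eta t n (b : 'S_t) (f : 'I_t -> 'M[K]_n) :
    (forall u, f u \in unitmx) ->
  steinberg #|Fq| eta (monmx b f)
    = monmx b (fun u => steinberg #|Fq| eta (f u)).
Proof.
move=> uf; rewrite /steinberg !(frobmxE iota) (map_monmx (frobq iota)).
case: ifP => _ //; rewrite invmx_monmx => [|u]; last by rewrite map_unitmx.
rewrite trmx_monmx invgK; apply: eq_monmx => u.
by rewrite permK.
Qed.

(** * Wreath products of matrix groups *)

Lemma scalar_center (Fq : finFieldType) (K : closedFieldType)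
    (iota : {rmorphism Fq -> K}) eta e n (B : {group GLF iota eta e n})
    (c : K) (x : GLF iota eta e n) :
  x \in B -> GLmx x = c%:M -> x \in 'Z(B)%g.
Proof.
move=> Bx xE; apply/centerP; split=> // b _; apply: val_inj.
by rewrite /= xE scalar_mxC.
Qed.

Section Wreath.

Context (Fq : finFieldType) (K : closedFieldType) (iota : {rmorphism Fq -> K}).
Context (eta : int) (t n : nat).
Notation G := (GLF iota eta 0 n).
Notation W := (GLF iota eta 0 (t * n)).
Notation SL := (SLF iota eta 0 (t * n)).
Implicit Types (s : 'S_t) (f h : 'I_t -> G).

Local Open Scope group_scope.

Fact wr_subproof s f : (monmx s (fun u => GLmx (f u)) \in unitmx) &&
  (iter (2 ^ 0) (steinberg #|Fq| eta) (monmx s (fun u => GLmx (f u)))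
     == monmx s (fun u => GLmx (f u))).
Proof.
rewrite monmx_unit => [|u]; last exact: GLmx_unit.
rewrite expn0 /= (steinberg_monmx iota) => [|u]; last exact: GLmx_unit.
by apply/eqP/eq_monmx => u; apply: (GLmx_fixed (f u)).
Qed.

Definition wr s f : W := MkGLF iota (wr_subproof s f).

Lemma wrM s1 s2 f1 f2 :
  wr s1 f1 * wr s2 f2 = wr (s1 * s2) (fun u => f1 u * f2 (s1 u)).
Proof. by apply: val_inj; rewrite /= monmxM. Qed.

Lemma eq_wr s f1 f2 : f1 =1 f2 -> wr s f1 = wr s f2.
Proof. by move=> eqf; apply/val_inj/eq_monmx => u /=; rewrite eqf. Qed.

Lemma wr1 : wr 1 (fun _ => 1) = 1.
Proof. by apply: val_inj; rewrite /= monmx1. Qed.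

Lemma wrV f : (wr 1 f)^-1 = wr 1 (fun u => (f u)^-1).
Proof.
apply/eqP; rewrite eq_invg_mul wrM mulg1 -wr1; apply/eqP/eq_wr => u.
by rewrite perm1 mulgV.
Qed.

Lemma wr_inj s1 s2 f1 f2 : (0 < n)%N ->
  wr s1 f1 = wr s2 f2 -> s1 = s2 /\ f1 =1 f2.
Proof.
move=> n_gt0 /(congr1 (fun X : W => GLmx X)) /= eq12.
have blk u v := congr1 (fun M => mxblk M u v) eq12.
have eqs u : s1 u = s2 u.
  have := blk u (s1 u); rewrite !monmxK eqxx; case: eqP => // _ f10.
  have := GLmx_unit (f1 u); rewrite f10 unitmxE; case: (n) n_gt0 => // n' _.
  by rewrite det0 unitr0.
split=> [|u]; first exact/permP.
by apply: val_inj; have := blk u (s1 u); rewrite !monmxK -eqs eqxx.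
Qed.

Lemma mx_wreathP (B : {set G}) (P : {set 'S_t}) X :
  reflect (exists s f, [/\ s \in P, forall u, f u \in B & X = wr s f])
          (X \in mx_wreath B P).
Proof.
rewrite inE; apply: (iffP exists_inP) => [[s Ps /existsP[f]] |].
  by case/andP=> /forallP Bf /eqP XE; exists s, f; split=> //;
    apply: val_inj; rewrite /= XE.
case=> s [f [Ps Bf ->]]; exists s => //; apply/existsP; exists [ffun u => f u].
apply/andP; split; first by apply/forallP=> u; rewrite ffunE.
by apply/eqP/mxblkP => u v /=; rewrite !blockmxK ffunE.
Qed.

Lemma base_conj f s h :
  wr 1 f ^ wr s h = wr 1 (fun u => f (s^-1 u) ^ h (s^-1 u)).
Proof.
apply: (mulgI (wr s h)); rewrite -conjgC !wrM mulg1 mul1g; apply: eq_wr => u.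
by rewrite perm1 permK -conjgC.
Qed.

Lemma base_comm f s h :
  [~ wr s h, wr 1 f] = wr 1 (fun u => (f (s^-1 u) ^ h (s^-1 u))^-1 * f u).
Proof.
rewrite commgEr wrV base_conj wrM mulg1; apply: eq_wr => u.
by rewrite perm1 conjVg.
Qed.

Lemma commg_SLF (X Y : W) : [~ X, Y] \in SL.
Proof.
rewrite inE commgEl conjgE /= !det_mulmx !det_inv.
have nz Z : \det (GLmx Z) != 0%R by rewrite -unitfE -unitmxE GLmx_unit.
by rewrite GRing.mulrA mulrACA !mulVf ?nz ?GRing.mul1r /= ?eqxx.
Qed.

End Wreath.

(** * The base group of a wreath product *)

Section BaseGroup.

Context (Fq : finFieldType) (K : closedFieldType) (iota : {rmorphism Fq -> K}).
Context (eta : int) (t n : nat).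
Notation G := (GLF iota eta 0 n).
Notation W := (GLF iota eta 0 (t * n)).
Notation SL := (SLF iota eta 0 (t * n)).
Implicit Types (s : 'S_t) (u v w : 'I_t) (f : 'I_t -> G).

Local Open Scope group_scope.

Definition single u (b : G) : 'I_t -> G := fun w => if w == u then b else 1.
(** For distinct blocks $u$ and $v$ its determinant is 1 whatever $b$ is, so that
    every $b \in B$ occurs as an entry of an element of $D_0$. *)
Definition dipole u v (b : G) : 'I_t -> G :=
  fun w => if w == u then b else if w == v then b^-1 else 1.

(** It is the commutator of a block transposition and an element supported on a
    single block. *)
Lemma dipole_SLF u v b : u != v -> wr 1 (dipole u v b) \in SL.
Proof.
move=> neq_uv.
suff ->: wr 1 (dipole u v b) = 
    [~ wr (tperm u v) (fun _ => 1), wr 1 (single u b)].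
  exact: commg_SLF.
rewrite base_comm; apply: eq_wr => w; rewrite conjg1 tpermV /dipole /single.
have ->: (tperm u v w == u) = (w == v).
  by rewrite -[RHS](inj_eq (@perm_inj _ (tperm u v))) tpermR.
have [-> | _] := eqVneq w u; first by rewrite (negPf neq_uv) invg1 mul1g.
by case: eqP; rewrite ?invg1 mulg1.
Qed.

Context (B : {group G}) (P : {set 'S_t}) (wrBP : {group W}).
Hypotheses (n_gt0 : (0 < n)%N) (defW : wrBP = mx_wreath B P :> {set W}).

Fact base_group_set : group_set (mx_wreath B [set 1 : 'S_t]).
Proof.
apply/group_setP; split=> [|X Y].
  apply/mx_wreathP; exists 1, (fun _ => 1).
  by split; rewrite ?set11 ?wr1 // => u; apply: group1.
case/mx_wreathP=> s1 [f1 [/set1P-> Bf1 ->]].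
case/mx_wreathP=> s2 [f2 [/set1P-> Bf2 ->]].
apply/mx_wreathP; rewrite wrM mulg1.
exists 1, (fun u => f1 u * f2 ((1 : 'S_t) u)).
by split=> [||//]; rewrite ?set11 // => u; rewrite groupM.
Qed.

Definition base_group : {group W} := Group base_group_set.
Notation D := base_group.
Notation R := (wrBP :&: SL).
Notation D0 := (D :&: SL).

Lemma base_groupP X :
  reflect (exists2 f, forall u, f u \in B & X = wr 1 f) (X \in D).
Proof.
apply: (iffP (mx_wreathP _ _ _)) => [[s [f [/set1P-> Bf ->]]] | [f Bf ->]].
  by exists f.
by exists 1, f; rewrite set11.
Qed.

Lemma mem_base f : (forall u, f u \in B) -> wr 1 f \in D.
Proof. by move=> Bf; apply/base_groupP; exists f. Qed.

Lemma single_mem (C : {group G}) u b v : b \in C -> single u b v \in C.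
Proof. by move=> Bb; rewrite /single; case: eqP. Qed.

Lemma dipole_mem (C : {group G}) u v b w : b \in C -> dipole u v b w \in C.
Proof.
by move=> Bb; rewrite /dipole; do 2?[case: ifP => // _]; rewrite groupV.
Qed.

Lemma base_sub : D \subset wrBP.
Proof.
have P1 : 1 \in P.
  have: 1 \in wrBP by apply: group1.
  rewrite defW -wr1 => /mx_wreathP[s [f [Ps _]]].
  by case/(wr_inj n_gt0)=> ->.
apply/subsetP=> _ /base_groupP[f Bf ->]; rewrite defW.
by apply/mx_wreathP; exists 1, f.
Qed.

Lemma base_norm : wrBP \subset 'N(D).
Proof.
rewrite defW; apply/subsetP=> _ /mx_wreathP[s [h [_ Bh ->]]].
rewrite inE; apply/subsetP=> _ /imsetP[_ /base_groupP[f Bf ->] ->].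
by rewrite base_conj mem_base // => u; rewrite groupJ.
Qed.

Lemma base_class2 : [~: B, B] \subset 'Z(B) -> [~: D, D] \subset 'C(D).
Proof.
move=> cl2; rewrite gen_subG; apply/subsetP.
move=> _ /imset2P[_ _ /base_groupP[h Bh ->] /base_groupP[f Bf ->] ->].
apply/centP=> _ /base_groupP[k Bk ->]; rewrite base_comm invg1.
rewrite /commute !wrM mulg1; apply: eq_wr => u; rewrite !perm1 -conjVg -commgEr.
have /(subsetP cl2)/centerP[_] : [~ h u, f u] \in [~: B, B].
  exact: mem_commg.
exact.
Qed.

Hypothesis (t_gt1 : (1 < t)%N).

Lemma other_point u : exists v, u != v.
Proof.
have [v] : exists v, v \in [set~ u].
  by apply/set0Pn; rewrite -card_gt0 cardsC1 card_ord -subn1 subn_gt0.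
by rewrite !inE eq_sym; exists v.
Qed.

(** Let $X$ commute with $D_0$.  The dipole of the scalar $i$ at $u, v$ gives
    $-i X_{uv} = i X_{uv}$, so $X$ is block diagonal; the dipoles of an arbitrary
    $b \in B$ then show that each diagonal block commutes with $B$. *)
Lemma cent_base_SLF (i : K) (j : G) :
    (2%:R != 0 :> K)%R -> (i ^+ 2 = -1)%R -> j \in B -> GLmx j = (i%:M)%R ->
  'C(D0) \subset 'C(D).
Proof.
move=> nz2 i2 Bj jE; apply/subsetP=> X /centP cX.
have Xdipole u v b : u != v -> b \in B ->
    (GLmx X *m monmx 1 (fun w => GLmx (dipole u v b w))
    = monmx 1 (fun w => GLmx (dipole u v b w)) *m GLmx X)%R.
  move=> neq_uv Bb; have := cX (wr 1 (dipole u v b)).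
  rewrite inE mem_base ?dipole_SLF // => [/(_ isT)/(congr1 val) //| w].
  exact: dipole_mem.
have blk u v b u' v' : u != v -> b \in B ->
    (mxblk (GLmx X) u' v' *m GLmx (dipole u v b v')
     = GLmx (dipole u v b u') *m mxblk (GLmx X) u' v')%R.
  move=> neq_uv Bb.
  have := congr1 (fun A => mxblk A u' v') (Xdipole u v b neq_uv Bb).
  by rewrite -{1}(perm1 v') mxblk_monr mxblk_monl perm1.
have Xuv u v : u != v -> mxblk (GLmx X) u v = 0%R.
  move=> neq_uv; have := blk u v j u v neq_uv Bj.
  rewrite /dipole eqxx eq_sym (negPf neq_uv) eqxx /= jE.
  have nzi : (i != 0)%R by rewrite -sqrf_eq0 i2 oppr_eq0 oner_eq0.
  have iV : (i^-1 = - i)%R.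
    by apply: (mulfI nzi); rewrite mulfV // mulrN -expr2 i2 opprK.
  rewrite invmx_scalar iV mul_scalar_mx mul_mx_scalar => /eqP.
  rewrite -subr_eq0 -scalerBl -opprD -mulr2n scaler_eq0 oppr_eq0.
  rewrite -mulr_natl mulf_eq0.
  by rewrite (negPf nz2) (negPf nzi) => /eqP.
apply/centP=> _ /base_groupP[f Bf ->]; apply: val_inj; apply: mxblkP => u v /=.
rewrite mxblk_monl -{1}(perm1 v) mxblk_monr perm1.
have [<- | neq_uv] := eqVneq u v; last by rewrite Xuv // mulmx0 mul0mx.
have [w neq_uw] := other_point u.
by have := blk u w (f u) u u neq_uw (Bf u); rewrite /dipole eqxx.
Qed.

(** A block permutation $s$ has determinant $\mathrm{sgn}(s)^n$, which is also
    the determinant of $\mathrm{sgn}(s)$ placed on one block; dividing by it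
    corrects $s$ to an element of determinant 1. *)
Lemma mx_wreath_mulS (e : G) : (2%:R != 0 :> K)%R ->
  e \in B -> GLmx e = (- 1)%R%:M%R -> wrBP \subset D * R.
Proof.
move=> nz2 Be eE; apply/subsetP=> X WX.
have: X \in mx_wreath B P by rewrite -defW.
case/mx_wreathP=> s [f [_ Bf XE]].
have [u _] : exists u : 'I_t, true by exists (Ordinal (ltnW t_gt1)).
pose es := e ^+ (s : bool); have Bes : es \in B by apply: groupX.
pose d := wr 1 f * wr 1 (single u es).
have Dd : d \in D.
  by rewrite groupM ?mem_base // => v; rewrite single_mem.
have det_e : (\det (GLmx (wr 1 (single u es))) = ((-1) ^+ s) ^+ n)%R.
  have ->: GLmx (wr 1 (single u es))
     = monmx 1 (fun w => ((if w == u then (-1) ^+ s else 1)%:M)%R).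
    apply: mxblkP => v w /=; rewrite !monmxK; case: eqP => // _.
    rewrite /single; case: eqP => // _.
    by rewrite /es; case: (odd_perm s); rewrite ?expg1.
  rewrite det_scalar_blocks (bigD1 u) //= eqxx big1 ?mulr1 // => v /negPf->.
  by rewrite expr1n.
have Xd : X = wr 1 f * wr s (fun _ => 1).
  by rewrite XE wrM mul1g; apply: eq_wr => v; rewrite mulg1.
rewrite -(mulKVg d X) mem_mulg //; apply/setIP; split.
  by rewrite groupM ?groupV //; apply: (subsetP base_sub).
rewrite Xd /d invMg mulgA -(mulgA _ _ (wr 1 f)) mulVg mulg1 inE /= det_mulmx.
by rewrite det_inv det_e det_perm_blocks // mulVf // expf_neq0 // signr_eq0.
Qed.

(** A conjugate of $f$ under $R$ has entries that are $B$-conjugates of powers of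
    $b$, up to a permutation of the blocks; these commute with the powers of $b$
    because $b^g \in b Z(B)$. *)
Lemma mem_abelian_classes f b : [~: B, B] \subset 'Z(B) -> b \in B ->
    (forall w, f w \in <[b]>) -> wr 1 f \in SL ->
  wr 1 f \in abelian_classes R.
Proof.
move=> cl2 Bb bf SLf.
have Df : wr 1 f \in D.
  by apply: mem_base => w; apply: subsetP (bf w); rewrite cycle_subG.
apply/abelian_classesP; split=> [|X /setIP[WX _]].
  by apply/setIP; rewrite (subsetP base_sub).
have: X \in mx_wreath B P by rewrite -defW.
case/mx_wreathP=> s [h [_ Bh ->]]; rewrite base_conj /commute !wrM mulg1.
apply: eq_wr => u; rewrite !perm1.
have /cycleP[k ->] := bf u; have /cycleP[l ->] := bf (s^-1 u).
rewrite conjXg; apply: commuteX2.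
have /centerP[_ cb] : [~ b, h (s^-1 u)] \in 'Z(B).
  by rewrite (subsetP cl2) ?mem_commg.
have ->: b ^ h (s^-1 u) = b * [~ b, h (s^-1 u)] by rewrite commgEl mulKVg.
by apply: commuteM => //; apply/commute_sym/cb.
Qed.

(** Multiplying by dipoles sweeps the entries of an element of $D_0$ into one
    block $u$; what remains there has determinant 1 and is again in the
    generating set. *)
Lemma base_SLF_sub_gen :
  [~: B, B] \subset 'Z(B) -> D0 \subset <<abelian_classes R>>.
Proof.
move=> cl2; apply/subsetP=> _ /setIP[/base_groupP[f Bf ->] SLf].
pose u : 'I_t := Ordinal (ltnW t_gt1).
have step (s : seq 'I_t) : u \notin s -> exists2 b, b \in B &
    wr 1 (fun w => if w \in s then f w else single u b w)
      \in <<abelian_classes R>>.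
  elim: s => [_ | x s IHs].
    exists 1 => //; suff ->: wr 1 (fun w => single u 1 w) = 1 by apply: group1.
    by rewrite -wr1; apply: eq_wr => w; rewrite /single if_same.
  rewrite inE negb_or => /andP[neq_ux us]; have [b Bb Mb] := IHs us.
  have [xs | xs] := boolP (x \in s).
    exists b => //; set h := (fun w => _) in Mb.
    rewrite (@eq_wr _ _ _ _ _ _ 1 _ h) //.
    by move=> w; rewrite /h inE; case: eqP => // ->; rewrite xs.
  exists ((f x)^-1 * b); first by rewrite groupM ?groupV.
  have Mx : wr 1 (dipole x u (f x)) \in <<abelian_classes R>>.
    apply/mem_gen/(mem_abelian_classes cl2 (Bf x)) => [w|].
      by apply: dipole_mem; apply: cycle_id.
    by rewrite dipole_SLF // eq_sym.
  set X := wr 1 _; suff ->: X = wr 1 (dipole x u (f x))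
      * wr 1 (fun w => if w \in s then f w else single u b w) by rewrite groupM.
  rewrite wrM mulg1; apply: eq_wr => w; rewrite perm1 inE /dipole /single.
  have [-> | _] := eqVneq w x.
    by rewrite (negPf xs) eq_sym (negPf neq_ux) mulg1.
  by have [-> | _] := eqVneq w u; rewrite ?(negPf us) ?mul1g.
have [|b Bb Mb] := step [seq w <- enum 'I_t | w != u].
  by rewrite mem_filter eqxx.
have SLg : {subset <<abelian_classes R>> <= SL}.
  apply/subsetP; rewrite gen_subG; apply/subsetP=> r; rewrite inE => /andP[].
  by case/setIP.
(* the quotient by m is supported on the block u *)
set m := wr 1 _ in Mb.
have defb : wr 1 (single u (b^-1 * f u)) = m^-1 * wr 1 f.
  rewrite wrV wrM mulg1; apply: eq_wr => w.
  rewrite perm1 mem_filter mem_enum andbT /single.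
  by case: eqP => [->|_] //=; rewrite mulVg.
rewrite -(mulKVg m (wr 1 f)) groupM // -defb.
apply/mem_gen/(@mem_abelian_classes _ (b^-1 * f u)) => //.
- by rewrite groupM ?groupV ?Bf.
- by move=> w; apply: single_mem; apply: cycle_id.
by rewrite defb groupM ?groupV //; apply: SLg.
Qed.


Section NotInBase.

Context (s : 'S_t) (f : 'I_t -> G).
Hypotheses (Wr : wr s f \in abelian_classes R).

(** The two sides are the entries at $s^{-1}(w)$ and $w$ of the commutator of
    the given element with $h$; this commutator commutes with that element, which
    permutes its central entries by $s$. *)
Lemma abelian_class_central h : (forall w, h w \in 'Z(B)) -> wr 1 h \in SL ->
  forall w, (h (s^-1 (s^-1 w)))^-1 * h (s^-1 w) = (h (s^-1 w))^-1 * h w.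
Proof.
move=> Zh SLh; have /abelian_classesP[/setIP[WX _] cr] := Wr.
have Bf : forall u, f u \in B.
  move: WX; rewrite defW => /mx_wreathP[s2 [f2 [_ Bf2]]].
  by case/(wr_inj n_gt0)=> _ ff2 u; rewrite ff2.
have Bh w : h w \in B by have /setIP[] := Zh w.
have Rh : wr 1 h \in R by apply/setIP; rewrite (subsetP base_sub) ?mem_base.
have fixZ z w : z \in 'Z(B) -> z ^ f w = z.
  by case/centerP=> _ cz; apply/conjg_fixP/commgP/cz.
have cE : [~ wr s f, wr 1 h] = wr 1 (fun u => (h (s^-1 u))^-1 * h u).
  by rewrite base_comm; apply: eq_wr => u; rewrite fixZ.
have: [~ wr s f, wr 1 h] ^ wr s f = [~ wr s f, wr 1 h].
  apply/conjg_fixP/commgP/commute_sym; rewrite commgEl.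
  by apply: commuteM; [apply/commuteV | apply: cr].
rewrite cE base_conj => /(wr_inj n_gt0)[_ eqh] w.
by rewrite -(eqh w) fixZ // groupM ?groupV.
Qed.

(** The commutators of the given element with $b_1$ and $b_2$ on the block $u$
    have the entries $b_1$ and $b_2$ there, the other nontrivial entry being on
    the block $s(u)$; as these commutators commute, so do $b_1$ and $b_2$. *)
Lemma abelian_class_comm u b1 b2 : s u != u -> b1 \in B -> b2 \in B ->
  wr 1 (single u b1) \in SL -> wr 1 (single u b2) \in SL -> commute b1 b2.
Proof.
move=> su Bb1 Bb2 SL1 SL2.
have Rs b : b \in B -> wr 1 (single u b) \in SL -> wr 1 (single u b) \in R.
  move=> Bb SLb; apply/setIP; split=> //.
  apply/(subsetP base_sub)/mem_base => v.
  exact: single_mem.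
have := abelian_classes_commg Wr (Rs b1 Bb1 SL1) (Rs b2 Bb2 SL2).
rewrite /commute !base_comm !wrM !mulg1 => /(wr_inj n_gt0)[_ /(_ u)].
have su' : s^-1 u != u by rewrite (canF_eq (permKV s)) eq_sym.
by rewrite !perm1 /single eqxx (negPf su') !conj1g invg1 !mul1g.
Qed.

End NotInBase.

Lemma abelian_classes_sub_base :
    (forall s f u, wr s f \in abelian_classes R -> s u = u) ->
  abelian_classes R \subset D0.
Proof.
move=> fixs; apply/subsetP=> r Ar.
have /abelian_classesP[/setIP[Wr SLr] _] := Ar.
apply/setIP; split=> //; move: Wr; rewrite defW => /mx_wreathP[s [f [_ Bf rE]]].
have s1 : s = 1 by apply/permP=> u; rewrite perm1 (fixs s f) -?rE.
by apply/base_groupP; exists f; rewrite // rE s1.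
Qed.

(** The three inputs of the stabilizer argument come together: $\tilde R = DR$,
    $C(D_0) \le C(D)$, and $D_0$ is generated by elements with abelian
    $R$-classes, hence normalized by $N(R)$. *)
Theorem wreath_special2 (i : K) (j : G) :
    (2%:R != 0 :> K)%R -> (i ^+ 2 = -1)%R -> j \in B -> GLmx j = (i%:M)%R ->
    [~: B, B] \subset 'Z(B) ->
    (forall s f u, wr s f \in abelian_classes R -> s u = u) ->
  radical2 [set: W] wrBP -> special2 [set: W] SL wrBP.
Proof.
move=> nz2 i2 Bj jE cl2 fixs radW; apply: radical2_special2 => //.
  exact: SLF_normal.
have [_ _ pW _] := radW; rewrite setTI.
have eE : GLmx (j * j) = (- 1)%R%:M%R.
  by rewrite /= jE -scalar_mxM -expr2 i2.
apply: subset_trans (mx_wreath_mulS nz2 (groupM Bj Bj) eE) _.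
have nSL (A : {set W}) : A \subset 'N(SL).
  by rewrite (subset_trans (subsetT A)) ?(normal_norm (SLF_normal _ _ _ _)).
have commSL (A1 A2 : {set W}) : [~: A1, A2] \subset SL.
  by rewrite gen_subG; apply/subsetP=> _ /imset2P[x y _ _ ->]; apply: commg_SLF.
have nRW : wrBP \subset 'N(R) by rewrite normsI ?normG.
have sD0R : D0 \subset R by rewrite setSI ?base_sub.
have defD0 : D0 = <<abelian_classes R>>.
  apply/eqP; rewrite eqEsubset base_SLF_sub_gen // gen_subG.
  exact: abelian_classes_sub_base.
have pR : 2.-group R by apply: pgroupS (subsetIl _ _) pW.
have nDR : [~: R, D] \subset D.
  by rewrite commg_subr (subset_trans (subsetIl _ _)) ?base_norm.
rewrite mulG_subG; apply/andP; split; last first.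
  by rewrite pcore_max // normalG.
have sDN := subset_trans base_sub nRW.
apply: (@stabilizer_sub_pcore _ [group of D0] [group of D] _ [group of R]);
  rewrite //.
- by rewrite /= defD0 norm_abelian_classes.
- exact: pgroupS base_sub pW.
- by rewrite /= subsetI nDR commSL.
- rewrite subsetI subsetI commSL andbT.
  rewrite (subset_trans (commSg _ (subsetIl _ _))) ?commg_subr ?normG //=.
  rewrite (subset_trans (commSg _ (subsetIl _ _))) //.
  by rewrite (subset_trans (base_class2 cl2)) ?centS ?subsetIl.
rewrite centsC (subset_trans (subsetIr _ _)) //.
exact: cent_base_SLF nz2 i2 Bj jE.
Qed.


(** Besides $u$, $s^{-1}(u)$ and $s^{-2}(u)$ there is a fourth block $w$; testing
    with the dipole of $i$ at $u, w$ leaves $i = 1$ or $i^2 = 1$ on the block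
    $u$. *)
Lemma fix_of_four_blocks (i : K) (j : G) :
    (2%:R != 0 :> K)%R -> (i ^+ 2 = -1)%R -> j \in B -> GLmx j = (i%:M)%R ->
    (3 < t)%N ->
  forall s f u, wr s f \in abelian_classes R -> s u = u.
Proof.
move=> nz2 i2 Bj jE t_gt3 s f u Ar; apply: contraTeq isT => su.
have su' : s^-1 u != u by rewrite (canF_eq (permKV s)) eq_sym.
have [w] : exists w, w \notin [:: u; s^-1 u; s^-1 (s^-1 u)].
  apply/existsP; rewrite -negb_forall; apply: contraL t_gt3 => /forallP all3.
  rewrite -leqNgt -[t]card_ord -(size_enum_ord t).
  have := @uniq_leq_size _ (enum 'I_t) [:: u; s^-1 u; s^-1 (s^-1 u)].
  rewrite enum_uniq size_enum_ord card_ord; apply=> // v _; apply: all3.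
rewrite !inE !negb_or => /and3P[wu wsu wssu].
have Zh v : dipole u w j v \in 'Z(B).
  by apply: dipole_mem; apply: scalar_center jE.
have uw : u != w by rewrite eq_sym.
have := abelian_class_central Ar Zh (dipole_SLF _ uw) u.
rewrite /dipole eqxx (negPf su').
rewrite ![_ == w]eq_sym (negPf wsu) (negPf wssu) invg1 mul1g mulg1 => jV.
have j2 : j * j != 1.
  apply/eqP=> /(congr1 val) /=; rewrite jE -scalar_mxM -expr2 i2.
  move/(scalar_mxI n_gt0)/eqP; rewrite eq_sym -subr_eq0 opprK.
  by rewrite (negPf nz2).
move: jV; case: ifP => _ jV.
  by rewrite -{2}jV mulgV eqxx in j2.
by rewrite -jV invg1 mulg1 eqxx in j2.
Qed.

(** With two blocks the element swaps them, and testing with the dipole of $J$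
    gives $J^{-2} = J^2$. *)
Lemma fix_of_central (J : G) : t = 2 -> J \in 'Z(B) -> J ^+ 4 != 1 ->
  forall s f u, wr s f \in abelian_classes R -> s u = u.
Proof.
move=> t2 ZJ J4 s f u Ar; apply: contraTeq isT => su.
have su' : s^-1 u != u by rewrite (canF_eq (permKV s)) eq_sym.
have ssu : s^-1 (s^-1 u) = u.
  apply: contraTeq isT => ssu.
  have : uniq [:: u; s^-1 u; s^-1 (s^-1 u)].
    by rewrite /= !inE negb_or !(eq_sym u) su' ssu (inj_eq perm_inj) eq_sym su'.
  move/card_uniqP=> /= c3.
  have := max_card (mem [:: u; s^-1 u; s^-1 (s^-1 u)]).
  by rewrite c3 card_ord t2.
have Zh v : dipole u (s^-1 u) J v \in 'Z(B) by apply: dipole_mem.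
have us' : u != s^-1 u by rewrite eq_sym.
have := abelian_class_central Ar Zh (dipole_SLF _ us') u.
rewrite ssu /dipole eqxx (negPf su') eqxx invgK => JV.
case/negP: J4; apply/eqP.
by rewrite (expgD J 2 2) -[J ^+ 2]/(J * J) -{2}JV mulgA mulgK mulgV.
Qed.

Lemma single_SLF u (b : G) : mx_commutator (GLmx b) ->
  wr 1 (single u b) \in SL.
Proof.
case=> g [h [ug uh bE]]; rewrite inE /=.
pose d x : 'I_t -> 'M[K]_n := fun w => if w == u then x else (1%:M)%R.
have ud x : x \in unitmx -> monmx 1 (d x) \in unitmx.
  by move=> ux; apply: monmx_unit => w; rewrite /d; case: ifP; rewrite ?unitmx1.
apply/eqP.
have nz : (\det (monmx 1 (d h)) * \det (monmx 1 (d g)) != 0)%R.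
  by rewrite mulf_neq0 // -unitfE -unitmxE ud.
apply: (mulIf nz); rewrite GRing.mul1r -!det_mulmx.
rewrite [in RHS]det_mulmx [RHS]GRing.mulrC -det_mulmx !monmxM !mulg1.
congr (\det _)%R; apply: eq_monmx => w; rewrite !perm1 /d /single.
by case: eqP => // _; rewrite !mul1mx.
Qed.

Lemma fix_of_noncommuting (b1 b2 : G) : b1 \in B -> b2 \in B ->
    mx_commutator (GLmx b1) -> mx_commutator (GLmx b2) -> ~ commute b1 b2 ->
  forall s f u, wr s f \in abelian_classes R -> s u = u.
Proof.
move=> Bb1 Bb2 c1 c2 nc s f u Ar; apply: contraTeq isT => su; case: nc.
by apply: (abelian_class_comm Ar su Bb1 Bb2); apply: single_SLF.
Qed.

End BaseGroup.

(** * The twisted embedding *)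

Section Kronecker.

Context (K : fieldType) (m n : nat).
Implicit Types (A : 'M[K]_m) (B : 'M[K]_n).

Lemma mxblk_tens A B u v : mxblk (tens B A) u v = A u v *: B.
Proof. by apply/matrixP=> i j; rewrite !mxE !mxtens_indexK. Qed.

Lemma tensM A1 A2 B1 B2 :
  tens B1 A1 *m tens B2 A2 = tens (B1 *m B2) (A1 *m A2).
Proof. exact: tensmx_mul. Qed.

Lemma tens11 : tens (1%:M : 'M[K]_n) (1%:M : 'M[K]_m) = 1%:M.
Proof.
apply: mxblkP => u v; rewrite mxblk_tens mxblk_scalar mxE eq_sym.
by case: eqP; rewrite ?scale1r ?scale0r.
Qed.

Lemma tens1V A : A \in unitmx ->
  tens (1%:M : 'M[K]_n) A \in unitmx
  /\ invmx (tens (1%:M : 'M[K]_n) A) = tens 1%:M (invmx A).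
Proof.
move=> uA; have VA : tens (1%:M : 'M[K]_n) A *m tens 1%:M (invmx A) = 1%:M.
  by rewrite tensM mulmx1 mulmxV // tens11.
have [uT _] := mulmx1_unit VA; split=> //.
by apply: (can_inj (mulKmx uT)); rewrite VA mulmxV.
Qed.

End Kronecker.

Lemma steinberg_tens1 (Fq : finFieldType) (K : closedFieldType)
    (iota : {rmorphism Fq -> K}) eta m n (A : 'M[K]_m) : A \in unitmx ->
  steinberg #|Fq| eta (tens (1%:M : 'M[K]_n) A)
    = tens 1%:M (steinberg #|Fq| eta A).
Proof.
move=> uA; rewrite /steinberg !(frobmxE iota) /tens map_mxT map_mx1.
case: ifP => // _; rewrite -/(tens _ _) (tens1V _ _).2 ?map_unitmx //.
by rewrite /tens trmx_tens trmx1.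
Qed.

Section Twist.

Context (Fq : finFieldType) (K : closedFieldType) (iota : {rmorphism Fq -> K}).
Context (eta : int) (m alpha gamma : nat).
Notation k := (2 ^ alpha)%N.
Notation N := (2 ^ gamma * m)%N.
Notation F := (steinberg #|Fq| eta).
Context (g1 : 'M[K]_k).
Hypothesis g1_lang : lang_elt #|Fq| eta g1.
Implicit Types A : 'M[K]_N.
Notation tw := (twist_mx Fq eta g1).
Notation G := (GLF iota eta alpha N).
Notation W := (GLF iota eta 0 (k * N)).

Lemma lang_unit : g1 \in unitmx.
Proof. by have [d1 _ _] := g1_lang; rewrite unitmxE d1 unitr1. Qed.

Let g : 'M[K]_(k * N) := tens 1%:M g1.
Let ug : g \in unitmx. Proof. exact: (tens1V _ lang_unit).1. Qed.
Let diagF A : 'M[K]_(k * N) := monmx 1%g (fun u => iter u F A).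

Lemma twist_mxE A : tw A = g *m diagF A *m invmx g.
Proof.
rewrite /twist_mx; congr (_ *m _ *m _); apply: mxblkP => u v.
by rewrite monmxK blockmxK perm1 eq_sym.
Qed.

Lemma twist_mxM A1 A2 : A1 \in unitmx -> A2 \in unitmx ->
  tw (A1 *m A2) = tw A1 *m tw A2.
Proof.
move=> u1 u2; rewrite !twist_mxE -!mulmxA mulKmx //; congr (_ *m _).
rewrite mulmxA monmxM mulg1; congr (_ *m _); apply: eq_monmx => u.
by rewrite perm1 (iter_steinbergM iota).
Qed.

Lemma twist_mx_unit A : A \in unitmx -> tw A \in unitmx.
Proof.
move=> uA; rewrite twist_mxE !unitmx_mul unitmx_inv ug andbT /=.
by apply: monmx_unit => u; rewrite (iter_steinberg_unit iota).
Qed.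

Lemma twist_scalar (c : K) : F (c%:M : 'M[K]_N) = c%:M ->
  tw (c%:M : 'M[K]_N) = c%:M.
Proof.
move=> Fc; have Dc : diagF (c%:M : 'M[K]_N) = c%:M.
  apply: mxblkP => u v; rewrite monmxK perm1 mxblk_scalar.
  by case: eqP => // _; elim: (u : nat) => //= j ->.
by rewrite twist_mxE Dc scalar_mxC mulmxK.
Qed.

(** Let $w = g_1^{-1} F(g_1)$.  A nonzero entry $w_{uv}$ occurs only for
    $u \equiv v + 1$ modulo $k$, where $F^u(A) = F^{v+1}(A)$; so $I \otimes w$
    conjugates $F(\mathrm{diag}(A, F(A), \dots))$ back to the same diagonal
    matrix. *)
Lemma twist_mx_fixed A : A \in unitmx -> iter k F A = A -> F (tw A) = tw A.
Proof.
move=> uA FkA; have [_ g1_k1 g1_gt1] := g1_lang.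
pose w := invmx g1 *m F g1.
have uFg1 : F g1 \in unitmx by rewrite (steinberg_unit iota) lang_unit.
have uw : w \in unitmx by rewrite unitmx_mul unitmx_inv lang_unit.
have Fg : F g = g *m tens 1%:M w.
  by rewrite steinberg_tens1 ?lang_unit // tensM mulmx1 mulKVmx ?lang_unit.
have [uW _] := tens1V N uw.
have uD : diagF A \in unitmx.
  by apply: monmx_unit => u; rewrite (iter_steinberg_unit iota).
have wE (u v : 'I_k) : w u v != 0 -> iter u F A = iter v.+1 F A.
  have [k1 | ] := leqP k 1.
    move=> _; have k_eq1 : k = 1%N by apply/eqP; rewrite eqn_leq k1 expn_gt0.
    have [-> ->] : (u : nat) = 0%N /\ (v : nat) = 0%N.
      have := ltn_ord u; have := ltn_ord v.
      by rewrite {2 4}k_eq1 !ltnS !leqn0 => /eqP-> /eqP->.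
    by have := FkA; rewrite [X in iter X _ _ = _]k_eq1 => /= ->.
  move/g1_gt1=> wlang; rewrite /w wlang mxE.
  have [-> // | _] := eqVneq (u : nat) v.+1.
  case: andP => [[/eqP-> /eqP->] _ | _]; last by rewrite eqxx.
  by rewrite prednK ?expn_gt0 // FkA.
have FD : tens 1%:M w *m F (diagF A) = diagF A *m tens 1%:M w.
  rewrite (steinberg_monmx iota) => [|u]; last first.
    by rewrite (iter_steinberg_unit iota).
  apply: mxblkP => u v.
  rewrite -{1}(perm1 v) mxblk_monr mxblk_monl !mxblk_tens perm1.
  rewrite -scalemxAl -scalemxAr mul1mx mulmx1.
  by have [-> | /wE ->] := eqVneq (w u v) 0; rewrite ?scale0r.
rewrite twist_mxE !(steinbergM iota) ?(steinbergV iota) ?unitmx_mul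
        ?unitmx_inv ?ug //.
rewrite Fg (invmxM ug uW) -!mulmxA; congr (_ *m _).
by rewrite !mulmxA FD mulmxK.
Qed.

Lemma twist_mx_inj A1 A2 : tw A1 = tw A2 -> A1 = A2.
Proof.
rewrite !twist_mxE => /(can_inj (mulmxK _)) eq12.
have {eq12}/(can_inj (mulKmx ug)) eq12 : g *m diagF A1 = g *m diagF A2.
  by apply: eq12; rewrite unitmx_inv.
pose u0 : 'I_k := Ordinal (expn_gt0 2 alpha : (0 < k)%N).
by have := congr1 (fun B => mxblk B u0 u0) eq12; rewrite !monmxK perm1 eqxx.
Qed.

Fact twist_subproof (A : G) :
  (tw A \in unitmx) && (iter (2 ^ 0) F (tw A) == tw A).
Proof.
by rewrite twist_mx_unit ?GLmx_unit //= twist_mx_fixed ?GLmx_unit ?GLmx_fixed.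
Qed.

Definition twist (A : G) : W := MkGLF iota (twist_subproof A).

Lemma twistM : {in [set: G] &, {morph twist : A1 A2 / (A1 * A2)%g}}.
Proof.
by move=> A1 A2 _ _; apply: val_inj; rewrite /= twist_mxM ?GLmx_unit.
Qed.

Canonical twist_morphism := Morphism twistM.

Lemma injm_twist : ('injm twist_morphism)%g.
Proof.
by apply/injmP=> A1 A2 _ _ /(congr1 val)/twist_mx_inj; apply: val_inj.
Qed.

Lemma basicE zeta :
  basic iota eta m gamma zeta g1
    = (twist_morphism @* basic0 iota eta m alpha gamma zeta)%g.
Proof.
rewrite morphimE setTI; apply/setP=> X; rewrite inE.
apply/exists_inP/imsetP=> [[A A0 /eqP XE] | [A A0 ->]]; exists A => //.
exact: val_inj.
Qed.

Lemma twist_commutator (A : G) : mx_commutator (GLmx A) -> mx_commutator (tw A).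
Proof.
case=> h1 [h2 [u1 u2 AE]].
exists (tw h1), (tw h2); split; try exact: twist_mx_unit.
by rewrite -!twist_mxM ?unitmx_mul ?u1 ?u2 ?GLmx_unit ?AE.
Qed.

End Twist.

(** * The matrices $x_j$ and $y_j$ *)

Section TensorPowers.

Context (K : fieldType).
Implicit Types (M : nat -> 'M[K]_2).

Lemma eq_tens_pow n M1 M2 : (forall j, (j < n)%N -> M1 j = M2 j) ->
  tens_pow n M1 = tens_pow n M2.
Proof.
elim: n => //= n IHn eqM; rewrite eqM // IHn // => j lt_jn.
by rewrite eqM // ltnS ltnW.
Qed.

Lemma castmxM_sq m n (e : m = n) (B1 B2 : 'M[K]_m) :
  castmx (e, e) B1 *m castmx (e, e) B2 = castmx (e, e) (B1 *m B2).
Proof. by case: n / e. Qed.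

Lemma castmx1 m n (e : m = n) : castmx (e, e) (1%:M : 'M[K]_m) = 1%:M.
Proof. by case: n / e. Qed.

Lemma tens_powM n M1 M2 :
  tens_pow n M1 *m tens_pow n M2 = tens_pow n (fun j => M1 j *m M2 j).
Proof. by elim: n => [|n IHn] /=; rewrite ?mulmx1 // castmxM_sq tensM IHn. Qed.

Lemma tens_pow1 n : tens_pow n (fun _ => 1%:M) = 1%:M :> 'M[K]_(2 ^ n).
Proof. by elim: n => //= n ->; rewrite tens11 castmx1. Qed.

Lemma trmx_tens_pow n M : (tens_pow n M)^T = tens_pow n (fun j => (M j)^T).
Proof.
by elim: n => [|n IHn] /=; rewrite ?trmx1 // trmx_cast /= /tens trmx_tens IHn.
Qed.

Lemma map_tens_pow (f : {rmorphism K -> K}) n M :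
  map_mx f (tens_pow n M) = tens_pow n (fun j => map_mx f (M j)).
Proof.
by elim: n => [|n IHn] /=; rewrite ?map_mx1 // map_castmx /tens map_mxT IHn.
Qed.

Lemma tens_powN n j M : (j < n)%N ->
  tens_pow n (fun l => if l == j then - M l else M l) = - tens_pow n M.
Proof.
elim: n => //= n IHn; rewrite ltnS leq_eqVlt => /orP[/eqP-> | lt_jn].
  rewrite eqxx (@eq_tens_pow n _ M) => [|l lt_ln]; last by rewrite ltn_eqF.
  by apply/matrixP=> u v; rewrite /tens !castmxE !mxE castmxE !mxE mulNr.
rewrite gtn_eqF // IHn //.
by apply/matrixP=> u v; rewrite /tens !castmxE !mxE castmxE !mxE mulrN.
Qed.

Lemma mx_xx : mx_x K *m mx_x K = 1%:M.
Proof.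
rewrite mulmx_diag; apply/matrixP=> u v; rewrite !mxE -expr2.
by rewrite sqrr_sign.
Qed.

Lemma mx_yy : mx_y K *m mx_y K = 1%:M.
Proof.
apply/matrixP=> u v; rewrite !mxE !big_ord_recl big_ord0 !mxE.
case: u => [[|[]]] //= ?; case: v => [[|[]]] //= ?;
by rewrite ?mulr0 ?mul0r ?mulr1 ?addr0 ?add0r.
Qed.

Lemma mx_xy : mx_x K *m mx_y K = - (mx_y K *m mx_x K).
Proof.
rewrite /mx_x mul_diag_mx mul_mx_diag; apply/matrixP=> u v; rewrite !mxE.
case: u => [[|[]]] //= ?; case: v => [[|[]]] //= ?;
by rewrite ?mulr0 ?mul0r ?mulr1 ?mul1r ?oppr0 ?opprK ?expr0 ?expr1.
Qed.

Lemma mx_xT : (mx_x K)^T = mx_x K. Proof. exact: tr_diag_mx. Qed.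

Lemma mx_yT : (mx_y K)^T = mx_y K.
Proof. by apply/matrixP=> u v; rewrite !mxE eq_sym. Qed.

Lemma map_mx_x (f : {rmorphism K -> K}) : map_mx f (mx_x K) = mx_x K.
Proof.
rewrite map_diag_mx; congr diag_mx; apply/rowP=> u.
by rewrite !mxE rmorphXn rmorphN1.
Qed.

Lemma map_mx_y (f : {rmorphism K -> K}) : map_mx f (mx_y K) = mx_y K.
Proof. by apply/matrixP=> u v; rewrite !mxE rmorph_nat. Qed.

Context (gamma : nat).

Definition at_pos j (A : 'M[K]_2) : 'M[K]_(2 ^ gamma) :=
  tens_pow gamma (fun i => if i == j then A else 1%:M).

Lemma at_posM j A B : at_pos j A *m at_pos j B = at_pos j (A *m B).
Proof.
rewrite /at_pos tens_powM; apply: eq_tens_pow => l _.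
by case: eqP; rewrite ?mulmx1.
Qed.

Lemma at_pos_comm j l A B : j != l ->
  at_pos j A *m at_pos l B = at_pos l B *m at_pos j A.
Proof.
move=> neq_jl; rewrite /at_pos !tens_powM; apply: eq_tens_pow => i _.
have [-> | _] := eqVneq i j; first by rewrite (negPf neq_jl) mulmx1 mul1mx.
by case: eqP; rewrite ?mulmx1 ?mul1mx.
Qed.

Lemma at_pos1 j : at_pos j 1%:M = 1%:M.
Proof.
rewrite /at_pos -(tens_pow1 gamma); apply: eq_tens_pow => l _.
by rewrite if_same.
Qed.

Lemma at_posN j A : (j < gamma)%N -> at_pos j (- A) = - at_pos j A.
Proof.
move=> lt_jg; rewrite /at_pos -(tens_powN _ lt_jg); apply: eq_tens_pow => l _.
by case: eqP.
Qed.

Lemma at_posT j A : (at_pos j A)^T = at_pos j A^T.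
Proof.
rewrite /at_pos trmx_tens_pow; apply: eq_tens_pow => l _.
by case: eqP; rewrite ?trmx1.
Qed.

Lemma map_at_pos (f : {rmorphism K -> K}) j A :
  map_mx f (at_pos j A) = at_pos j (map_mx f A).
Proof.
rewrite /at_pos map_tens_pow; apply: eq_tens_pow => l _.
by case: eqP; rewrite ?map_mx1.
Qed.

End TensorPowers.

(** * Basic subgroups *)

Section Scalars.

Context (Fq : finFieldType) (K : closedFieldType) (iota : {rmorphism Fq -> K}).
Context (eta : int) (N : nat).
Notation F := (@steinberg K #|Fq| eta N).
Hypothesis eta_sign : eta = 1 \/ eta = -1.

Lemma steinberg_scalar (c : K) : F c%:M = (c ^ (eta * #|Fq|%:Z))%:M.
Proof.
rewrite /steinberg (frobmxE iota) map_scalar_mx /frobq.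
case: eta_sign => ->; rewrite ?mul1r //=.
by rewrite invmx_scalar tr_scalar_mx mulN1r -exprnN.
Qed.

Lemma iter_steinberg_scalar k (c : K) :
  iter k F c%:M = (c ^ ((eta * #|Fq|%:Z) ^+ k))%:M.
Proof.
elim: k => [|k IHk] /=; first by rewrite expr0 expr1z.
by rewrite IHk steinberg_scalar exprz_exp -exprSr.
Qed.

End Scalars.

Lemma exprz_prim_root (K : fieldType) n (x : K) (z : int) :
  n.-primitive_root x -> (n %| z - 1)%Z -> x ^ z = x.
Proof.
move=> prx /dvdzP[y zE].
have {zE} ->: z = 1 + n%:Z * y by rewrite mulrC -zE addrC subrK.
have nz_x : x != 0.
  apply/eqP=> x0; have /eqP := prim_expr_order prx.
  by rewrite x0 expr0n eqn0Ngt (prim_order_gt0 prx) eq_sym oner_eq0.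
rewrite expfzDr // expr1z -exprz_exp -exprnP (prim_expr_order prx).
by rewrite exp1rz mulr1.
Qed.

(** Each squaring gains a factor 2, from $y^2 - 1 = (y - 1)(y + 1)$ with $y$
    odd. *)
Lemma dvdz_exp2_sub1 (b alpha : nat) (x : int) : (0 < b)%N ->
  ((2 ^ b)%N %| x - 1)%Z -> ((2 ^ (b + alpha))%N %| x ^+ (2 ^ alpha) - 1)%Z.
Proof.
move=> b_gt0 dvx; elim: alpha => [|n IHn]; first by rewrite addn0 expr1.
have ->: x ^+ (2 ^ n.+1) - 1 = (x ^+ (2 ^ n) - 1) * (x ^+ (2 ^ n) - 1 + 2%:Z).
  by rewrite expnSr exprM -[1 in LHS](expr1n _ 2) subr_sqr -addrA.
rewrite addnS expnSr PoszM dvdz_mul // rpredD // (dvdz_trans _ IHn) //.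
by rewrite dvdzE /= -{1}(expn1 2) dvdn_exp2l // (leq_trans b_gt0) ?leq_addr.
Qed.

Lemma prim_root_sqrtN1 (K : fieldType) b (z : K) :
  (2 ^ (2 + b)).-primitive_root z -> 4.-primitive_root (z ^+ (2 ^ b)).
Proof.
move=> prz; have d4 : (4 %| 2 ^ (2 + b))%N by rewrite expnD dvdn_mulr.
have := dvdn_prim_root prz d4; congr (_.-primitive_root (_ ^+ _)).
by rewrite expnD mulKn.
Qed.

Lemma prim_root4_sqr (K : fieldType) (z : K) : 4.-primitive_root z ->
  z ^+ 2 = -1 /\ 2%:R != 0 :> K.
Proof.
move=> prz; have z2_neq1 : z ^+ 2 != 1 by rewrite -(prim_order_dvd prz).
have z2 : z ^+ 2 = -1.
  apply/eqP; rewrite -addr_eq0; have: (z ^+ 2 - 1) * (z ^+ 2 + 1) == 0.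
    by rewrite -subr_sqr -exprM expr1n (prim_expr_order prz) subrr.
  by rewrite mulf_eq0 subr_eq0 (negPf z2_neq1).
split=> //; apply: contra z2_neq1 => two0.
by rewrite z2 eq_sym -addr_eq0.
Qed.

Section Basic.

Context (Fq : finFieldType) (K : closedFieldType) (iota : {rmorphism Fq -> K}).
Context (eta : int) (m alpha gamma : nat).
Notation N := (2 ^ gamma * m)%N.
Notation F := (@steinberg K #|Fq| eta N).
Notation G := (GLF iota eta alpha N).

Lemma GLF_exp_scalar e n (g : GLF iota eta e n) (c : K) k :
  GLmx g = c%:M -> GLmx (g ^+ k)%g = (c ^+ k)%:M.
Proof.
move=> gE; elim: k => [|k IHk]; first by rewrite expg0 expr0.
by rewrite expgS exprS /= gE IHk scalar_mxM.
Qed.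

Definition sign_scalars e n : {set GLF iota eta e n} :=
  [set g | (GLmx g == 1%:M) || (GLmx g == (-1)%:M)].

Fact sign_scalars_group_set e n : group_set (sign_scalars e n).
Proof.
apply/group_setP; split=> [|g h]; first by rewrite inE eqxx.
rewrite !inE /=; case/orP=> /eqP->; case/orP=> /eqP->;
by rewrite -scalar_mxM ?mulrNN ?mulr1 ?mul1r eqxx ?orbT.
Qed.

Canonical sign_scalars_group e n := Group (sign_scalars_group_set e n).

(** Generators that commute up to sign have commutators in the central subgroup
    $\{\pm 1\}$, modulo which the generated group is abelian. *)
Lemma gen_class2 e n (S : {set GLF iota eta e n}) :
    {in S &, forall g h, GLmx g *m GLmx h = GLmx h *m GLmx g
                     \/ GLmx g *m GLmx h = - (GLmx h *m GLmx g)} ->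
  ([~: <<S>>, <<S>>] \subset 'Z(<<S>>))%g.
Proof.
move=> S2; set Z := sign_scalars e n.
have cZ (A : {set GLF iota eta e n}) : (A \subset 'C(Z))%g.
  apply/subsetP=> x _; apply/centP=> z; rewrite inE => zE; apply: val_inj => /=.
  by case/orP: zE => /eqP->; rewrite scalar_mxC.
have nZ (A : {set GLF iota eta e n}) : (A \subset 'N(Z))%g.
  exact: subset_trans (cZ A) (cent_sub _).
have sSZ : ([~: S, S] \subset Z)%g.
  rewrite gen_subG; apply/subsetP=> _ /imset2P[g h Sg Sh ->].
  have ghE : GLmx (g * h)%g = GLmx (h * g)%g *m GLmx [~ g, h]%g.
    by rewrite -[LHS]/(GLmx (g * h)%g) commgC.
  have Vhg : GLmx (h * g)%g \in unitmx by apply: GLmx_unit.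
  rewrite inE; apply/orP.
  case: (S2 g h Sg Sh) => /= gh; [left | right]; apply/eqP.
    by apply: (can_inj (mulKmx Vhg)); rewrite -ghE mulmx1.
  apply: (can_inj (mulKmx Vhg)); rewrite -ghE [LHS]gh.
  by rewrite mul_mx_scalar scaleN1r.
have sZ : ([~: <<S>>, <<S>>] \subset Z)%g.
  rewrite -quotient_cents2 ?nZ // quotient_gen ?nZ //.
  by rewrite -/(abelian _) abelian_gen /abelian quotient_cents2 ?nZ.
by rewrite subsetI commg_subr normG (subset_trans sZ) // centsC cZ.
Qed.

(** The matrix $I_m \otimes (I_2 \otimes \dots \otimes A \otimes \dots
    \otimes I_2)$ with $A$ in position $j$, so that $A = x, y$ gives the
    generators $I_m \otimes x_j$, $I_m \otimes y_j$. *)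
Definition mx_pos j (A : 'M[K]_2) : 'M[K]_N := tens 1%:M (at_pos gamma j A).

Lemma mx_posM j A B : mx_pos j A *m mx_pos j B = mx_pos j (A *m B).
Proof. by rewrite tensM at_posM mulmx1. Qed.

Lemma mx_pos1 j : mx_pos j 1%:M = 1%:M.
Proof. by rewrite /mx_pos at_pos1 tens11. Qed.

Lemma mx_posN j A : (j < gamma)%N -> mx_pos j (- A) = - mx_pos j A.
Proof.
move=> lt_j; rewrite /mx_pos at_posN //; apply/matrixP=> u v.
by rewrite /tens !mxE mulNr.
Qed.

Lemma mx_pos_comm j l A B : j != l ->
  mx_pos j A *m mx_pos l B = mx_pos l B *m mx_pos j A.
Proof.
by move=> neq_jl; rewrite /mx_pos !tensM (at_pos_comm _ _ _ neq_jl) mulmx1.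
Qed.

Lemma mx_pos_fixed j A k : A *m A = 1%:M -> A^T = A ->
    (forall f : {rmorphism K -> K}, map_mx f A = A) ->
  (mx_pos j A \in unitmx) && (iter k F (mx_pos j A) == mx_pos j A).
Proof.
move=> AA AT fA; have pp : mx_pos j A *m mx_pos j A = 1%:M.
  by rewrite mx_posM AA mx_pos1.
have [up _] := mulmx1_unit pp; rewrite up; apply/eqP.
suff Fp : F (mx_pos j A) = mx_pos j A by elim: k => //= k ->.
rewrite /steinberg (frobmxE iota).
have ->: map_mx (frobq iota) (mx_pos j A) = mx_pos j A.
  by rewrite /mx_pos /tens map_mxT map_mx1 map_at_pos fA.
case: ifP => // _; have ->: invmx (mx_pos j A) = mx_pos j A.
  by apply: (can_inj (mulKmx up)); rewrite pp mulmxV.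
by rewrite /mx_pos /tens trmx_tens trmx1 at_posT AT.
Qed.

Definition pos_x j : G := MkGLF iota
  (mx_pos_fixed j (2 ^ alpha) (mx_xx K) (mx_xT K) (@map_mx_x K)).
Definition pos_y j : G := MkGLF iota
  (mx_pos_fixed j (2 ^ alpha) (mx_yy K) (mx_yT K) (@map_mx_y K)).

Lemma basic0_gensP zeta (g : G) :
  g \in basic0_gens iota eta m alpha gamma zeta ->
  [\/ GLmx g = zeta%:M, exists2 j, (j < gamma)%N & GLmx g = mx_pos j (mx_x K)
    | exists2 j, (j < gamma)%N & GLmx g = mx_pos j (mx_y K)].
Proof.
rewrite inE => /orP[/eqP | /existsP[j /orP[] /eqP]] gE; first by constructor 1.
- by constructor 2; exists j.
by constructor 3; exists j.
Qed.

Lemma basic0_class2 zeta (B := basic0 iota eta m alpha gamma zeta) :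
  ([~: B, B] \subset 'Z(B))%g.
Proof.
apply: gen_class2 => g h /basic0_gensP Sg /basic0_gensP Sh.
have posC j l A1 A2 : (j < gamma)%N -> A1 *m A2 = - (A2 *m A1) ->
    mx_pos j A1 *m mx_pos l A2 = mx_pos l A2 *m mx_pos j A1
    \/ mx_pos j A1 *m mx_pos l A2 = - (mx_pos l A2 *m mx_pos j A1).
  move=> lt_j AA; have [<- | /mx_pos_comm->] := eqVneq j l; last by left.
  by right; rewrite !mx_posM AA mx_posN.
have posC1 j l A : mx_pos j A *m mx_pos l A = mx_pos l A *m mx_pos j A.
  by have [<- // | /mx_pos_comm->] := eqVneq j l.
have yx : mx_y K *m mx_x K = - (mx_x K *m mx_y K) by rewrite mx_xy opprK.
case: Sg => [->|[j lt_j ->]|[j lt_j ->]]; first by left; rewrite scalar_mxC.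
  case: Sh => [->|[l lt_l ->]|[l lt_l ->]]; first by left; rewrite scalar_mxC.
    by left; apply: posC1.
  exact/posC/mx_xy.
case: Sh => [->|[l lt_l ->]|[l lt_l ->]]; first by left; rewrite scalar_mxC.
  exact: posC.
by left; apply: posC1.
Qed.

Lemma pos_x_mem zeta j : (j < gamma)%N ->
  pos_x j \in basic0 iota eta m alpha gamma zeta.
Proof.
move=> lt_j; rewrite mem_gen // inE; apply/orP; right.
by apply/existsP; exists (Ordinal lt_j); rewrite eqxx.
Qed.

Lemma pos_y_mem zeta j : (j < gamma)%N ->
  pos_y j \in basic0 iota eta m alpha gamma zeta.
Proof.
move=> lt_j; rewrite mem_gen // inE; apply/orP; right.
by apply/existsP; exists (Ordinal lt_j); rewrite eqxx orbT.
Qed.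

End Basic.

(** Since $y$ anticommutes with $x$, it conjugates $h = 1 - ix$ to $1 + ix$,
    and $(1 + ix) h^{-1} = ix$ because $(ix)^2 = -1$. *)
Lemma mx_commutator_involutions (K : fieldType) n (i : K) (x y : 'M[K]_n) :
    2%:R != 0 :> K -> i ^+ 2 = -1 -> x *m x = 1%:M -> y *m y = 1%:M ->
    x *m y = - (y *m x) ->
  mx_commutator (i *: x).
Proof.
move=> nz2 i2 xx yy xy; have [uy _] := mulmx1_unit yy.
have hh : (1%:M - i *: x) *m (1%:M + i *: x) = (2%:R)%:M.
  rewrite mulmxBl !mulmxDr !mul1mx mulmx1 -scalemxAl -scalemxAr scalerA xx.
  by rewrite -expr2 i2 scaleN1r opprD opprK addrA addrK -raddfD.
have uh : 1%:M - i *: x \in unitmx.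
  suff: (1%:M - i *: x) *m (1%:M + i *: x) \in unitmx.
    by rewrite unitmx_mul => /andP[].
  by rewrite hh unitmxE det_scalar unitfE expf_neq0.
exists y, (1%:M - i *: x); split=> //.
rewrite mulmxA mulmxBr mulmx1 -!(scalemxAl, scalemxAr) scalerA xx -expr2 i2.
rewrite scaleN1r opprK mulmxBr mulmxDl mulmx1 mul1mx -scalemxAl xy scalerN.
by rewrite scalemxAr addrC.
Qed.

(** * Basic subgroups that are wreath products *)

Lemma mx_wreath_scalar_SLF (Fq : finFieldType) (K : closedFieldType)
    (iota : {rmorphism Fq -> K}) eta t n
    (B : {set GLF iota eta 0 n}) (P : {set 'S_t}) :
    2%:R != 0 :> K -> ~~ odd n ->
    (forall b, b \in B -> exists2 c, GLmx b == c%:M & c ^+ n == 1) ->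
  mx_wreath B P \subset SLF iota eta 0 (t * n).
Proof.
move=> nz2 even_n scalB; apply/subsetP=> _ /mx_wreathP[s [f [_ Bf ->]]].
have -> : wr s f = (wr 1 f * wr s (fun _ => 1))%g.
  by rewrite wrM mul1g; apply: eq_wr => u; rewrite mulg1.
rewrite inE /= det_mulmx det_perm_blocks // exprAC -(signr_odd K n).
rewrite (negPf even_n) expr0 expr1n mulr1.
pose d u := s2val (sig2W (scalB _ (Bf u))).
have dE u : GLmx (f u) = (d u)%:M by apply/eqP; rewrite /d; case: sig2W.
rewrite (eq_monmx 1%g dE) det_scalar_blocks big1 // => u _.
by apply/eqP; rewrite /d; case: sig2W.
Qed.

Lemma sumn_pos_eq1 c : all (fun d => 0 < d)%N c -> c <> [::] ->
  c = [:: 1%N] \/ (1 < sumn c)%N.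
Proof.
case: c => [|d [|d' c]] //= /andP[d_gt0 pos_c] _.
  by rewrite addn0; case: d d_gt0 => [|[|d]] // _; [left | right].
case/andP: pos_c => d'_gt0 _; right.
by rewrite addnA (leq_trans _ (leq_addr _ _)) // (leq_add d_gt0 d'_gt0).
Qed.

Theorem proposition4p32
  (p f q : nat) (p_prime : prime p) (p_odd : odd p)
  (f_gt0 : (0 < f)%N) (q_def : q = (p ^ f)%N)
  (eta : int) (eta_sign : eta = 1 \/ eta = -1)
  (q_eta : (4 %| q%:Z - eta)%Z)
  (Fq : finFieldType) (card_Fq : #|Fq| = q)
  (K : closedFieldType) (iota : {rmorphism Fq -> K})
  (K_alg : forall x : K, algebraicOver iota x)
  (a : nat) (a_def : a = logn 2 `|q%:Z - eta|%N)
  (m alpha gamma : nat) (m_gt0 : (0 < m)%N)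
  (c : seq nat) (c_pos : all (fun d => 0 < d)%N c) (c_neq0 : c <> [::])
  (zeta : K) (zeta_order : (2 ^ (a + alpha)).-primitive_root zeta)
  (g1 : 'M[K]_(2 ^ alpha)) (g1_lang : lang_elt q eta g1)
  (A : forall d : nat, {group 'S_(2 ^ d)})
  (A_regular : forall d : nat, regular_abelem (A d)) :
  radical2 [set: GLF iota eta 0 (basic_dim m alpha gamma c)]
           (basic_subgroup iota eta zeta A m gamma c g1) ->
  ~ [/\ a = 2, alpha = 0, gamma = 0, logn 2 m <= 1 & c = [:: 1]]%N ->
  special2 [set: GLF iota eta 0 (basic_dim m alpha gamma c)]
           (SLF iota eta 0 (basic_dim m alpha gamma c))
           (basic_subgroup iota eta zeta A m gamma c g1).
Proof.
move=> radR not_exc; have qF := card_Fq; rewrite -{}card_Fq in g1_lang.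
set n := (2 ^ alpha * (2 ^ gamma * m))%N.
have n_gt0 : (0 < n)%N by rewrite !muln_gt0 !expn_gt0 m_gt0.
have N_gt0 : (0 < 2 ^ gamma * m)%N by rewrite muln_gt0 expn_gt0 m_gt0.
(* eta q - 1 = eta (q - eta), so eta q is 1 modulo 2 ^ a *)
pose eq := eta * #|Fq|%:Z.
have eqE : eq - 1 = eta * (q%:Z - eta).
  by rewrite /eq qF mulrBr; case: eta_sign => ->; rewrite ?mulr1 ?mulrNN ?mulr1.
have q_gt2 : (2 < q)%N.
  have p_gt2 : (2 < p)%N by rewrite odd_prime_gt2.
  by rewrite q_def (leq_trans p_gt2) // -{1}(expn1 p) leq_exp2l ?prime_gt1.
have nz_qeta : (0 < `|q%:Z - eta|)%N.
  rewrite absz_gt0 subr_eq0; apply: contraTneq q_gt2 => qE.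
  by case: eta_sign qE => -> // [->].
have a_gt1 : (1 < a)%N.
  by rewrite a_def -pfactor_dvdn //; move: q_eta; rewrite dvdzE.
have dvd_eq : ((2 ^ a)%N %| eq - 1)%Z.
  by rewrite eqE dvdz_mull // dvdzE /= a_def pfactor_dvdnn.
have a_gt0 : (0 < a)%N by apply: ltnW.
have dvd_eqk : ((2 ^ (a + alpha))%N %| eq ^+ (2 ^ alpha) - 1)%Z.
  exact: dvdz_exp2_sub1.
pose i := zeta ^+ (2 ^ (a + alpha - 2)).
have a2 : (2 + (a + alpha - 2) = a + alpha)%N.
  by rewrite subnKC // (leq_trans a_gt1) ?leq_addr.
have pri : 4.-primitive_root i by apply: prim_root_sqrtN1; rewrite a2.
have [i2 nz2] := prim_root4_sqr pri.
have Fi N : @steinberg K #|Fq| eta N i%:M = i%:M.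
  rewrite (steinberg_scalar iota) //; congr (_%:M).
  apply: exprz_prim_root pri _.
  by rewrite -/eq eqE dvdz_mull.
pose zM : 'M[K]_(2 ^ gamma * m) := zeta%:M.
have zG_sub : (zM \in unitmx)
    && (iter (2 ^ alpha) (steinberg #|Fq| eta) zM == zM).
  rewrite unitmxE det_scalar unitfE expf_neq0; last first.
    apply/eqP=> z0; have /eqP := prim_expr_order zeta_order.
    by rewrite z0 expr0n expn_eq0 /= eq_sym oner_eq0.
  by rewrite (iter_steinberg_scalar iota) // (exprz_prim_root zeta_order) ?eqxx.
pose zG : GLF iota eta alpha (2 ^ gamma * m) := MkGLF iota zG_sub.
have zGE : GLmx zG = zeta%:M by [].
pose B0 := [group of <<basic0_gens iota eta m alpha gamma zeta>>%g].
have zB0 : zG \in B0 by rewrite mem_gen // inE eqxx.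
pose tw := twist_morphism iota m gamma g1_lang.
pose B := (tw @* B0)%G.
have defB : basic iota eta m gamma zeta g1 = B :> {set _} by apply: basicE.
have memB x : x \in B0 -> twist g1_lang x \in B.
  by move=> B0x; apply: (mem_morphim tw); rewrite ?inE.
have cl2 : ([~: B, B] \subset 'Z(B))%g.
  rewrite -morphimR ?subsetT //.
  apply: subset_trans (morphimS _ (basic0_class2 iota eta m alpha gamma zeta)) _.
  exact: morphim_center.
pose jG := twist g1_lang (zG ^+ (2 ^ (a + alpha - 2)))%g.
have Bj : jG \in B by rewrite memB ?groupX.
have jE : GLmx jG = i%:M.
  by rewrite /= (GLF_exp_scalar _ zGE) (twist_scalar g1_lang).
have [gR _ _ _] := radR; pose wrB := Group gR.
have defW : wrB = mx_wreath B (iter_wreath A c) :> {set _} by rewrite -defB.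
have t_gt1 : (1 < 2 ^ sumn c)%N.
  rewrite -{1}(expn0 2) ltn_exp2l //.
  by have [-> | /ltnW] := sumn_pos_eq1 c_pos c_neq0.
pose SL := SLF_group iota eta 0 (basic_dim m alpha gamma c).
have [triv | fixs] : (wrB \subset SL) \/ (forall s h u,
    wr s h \in abelian_classes (wrB :&: SL)%g -> s u = u).
(* the first alternative occurs only when B consists of scalars and 4 divides m *)
- have [c1 | c_gt1] := sumn_pos_eq1 c_pos c_neq0; last first.
    right; apply: (fix_of_four_blocks n_gt0 defW nz2 i2 Bj jE).
    by rewrite -[3%N]/((2 ^ 2).-1)%N prednK ?leq_exp2l.
  pose toM (X : GLF iota eta alpha (2 ^ gamma * m)) := GLmx X.
  have inj_tw := injmP (injm_twist iota m gamma g1_lang).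
  have [g_gt0 | g_eq0] := ltnP 0 gamma.
    right; pose iG := (zG ^+ (2 ^ (a + alpha - 2)))%g.
    pose x := pos_x iota eta m alpha gamma 0.
    pose y := pos_y iota eta m alpha gamma 0.
    have iGE : GLmx iG = i%:M by rewrite (GLF_exp_scalar _ zGE).
    have B0x : (iG * x)%g \in B0 by rewrite groupM ?groupX // pos_x_mem.
    have B0y : (iG * y)%g \in B0 by rewrite groupM ?groupX // pos_y_mem.
    have xx : GLmx x *m GLmx x = 1%:M by rewrite /= mx_posM mx_xx mx_pos1.
    have yy : GLmx y *m GLmx y = 1%:M by rewrite /= mx_posM mx_yy mx_pos1.
    have xy : GLmx x *m GLmx y = - (GLmx y *m GLmx x).
      by rewrite /= !mx_posM mx_xy mx_posN.
    have yx : GLmx y *m GLmx x = - (GLmx x *m GLmx y) by rewrite xy opprK.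
    apply: (fix_of_noncommuting n_gt0 defW (memB _ B0x) (memB _ B0y)).
    - have := mx_commutator_involutions nz2 i2 xx yy xy.
      rewrite -mul_scalar_mx -iGE.
      exact: (@twist_commutator _ _ iota _ _ _ _ _ g1_lang (iG * x)%g).
    - have := mx_commutator_involutions nz2 i2 yy xx yx.
      rewrite -mul_scalar_mx -iGE.
      exact: (@twist_commutator _ _ iota _ _ _ _ _ g1_lang (iG * y)%g).
    rewrite /commute -!twistM ?in_setT // => /inj_tw; rewrite !in_setT.
    move=> /(_ isT isT)/(congr1 toM).
    rewrite -[LHS]/(GLmx iG *m GLmx x *m (GLmx iG *m GLmx y)).
    rewrite -[RHS]/(GLmx iG *m GLmx y *m (GLmx iG *m GLmx x)).
    rewrite iGE !mul_scalar_mx -!scalemxAl -!scalemxAr !scalerA -expr2 i2.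
    rewrite !scaleN1r => /oppr_inj; rewrite [LHS]xy => /eqP.
    rewrite eq_sym -addr_eq0 -mulr2n -scaler_nat scaler_eq0 (negPf nz2).
    move=> /eqP yx0.
    have : GLmx (y * x)%g \in unitmx by apply: GLmx_unit.
    rewrite [GLmx _]yx0 unitmxE; case: (_ * m)%N N_gt0 => // N' _.
    by rewrite det0 unitr0.
  have t2 : (2 ^ sumn c = 2)%N by rewrite c1.
  have [aa_gt2 | aa_le2] := ltnP 2 (a + alpha).
    right; apply: (fix_of_central n_gt0 defW t2 (J := twist g1_lang zG)).
      suff: twist g1_lang zG \in (tw @* 'Z(B0))%g.
        exact/subsetP/morphim_center.
      apply: (mem_morphim tw); first exact: in_setT.
      exact: scalar_center zB0 (erefl _).
    rewrite -(morphX tw) ?in_setT //.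
    rewrite (morph_injm_eq1 (injm_twist iota m gamma g1_lang)) ?in_setT //.
    apply/eqP => /(congr1 toM); rewrite /toM.
    rewrite (GLF_exp_scalar _ zGE) => /(scalar_mxI N_gt0)/eqP.
    rewrite -(prim_order_dvd zeta_order) -[4%N]/(2 ^ 2)%N dvdn_Pexp2l // leqNgt.
    by rewrite aa_gt2.
  have a_eq2 : a = 2%N.
    by apply/eqP; rewrite eqn_leq a_gt1 (leq_trans (leq_addr _ _) aa_le2).
  have alpha0 : alpha = 0%N.
    by apply/eqP; rewrite -leqn0 -(leq_add2l a) addn0 {2}a_eq2.
  have gamma0 : gamma = 0%N by apply/eqP; rewrite -leqn0.
  have m4 : (4 %| m)%N.
    rewrite -[4%N]/(2 ^ 2)%N pfactor_dvdn // ltnNge; apply/negP=> m_le1.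
    by case: not_exc.
  have n4 : (4 %| n)%N by rewrite !dvdn_mull.
  have k1 : (2 ^ alpha = 1)%N by rewrite alpha0.
  have sB0 : B0 \subset <[zG]>%g.
    have no_j j : (j < gamma)%N -> False.
      by move/(leq_ltn_trans (leq0n j)); rewrite ltnNge g_eq0.
    rewrite gen_subG; apply/subsetP=> x.
    case/basic0_gensP=> [xE | [j /no_j] | [j /no_j]] //.
    by rewrite (_ : x = zG) ?cycle_id //; apply: val_inj.
  left; rewrite defW; apply: mx_wreath_scalar_SLF => //.
    by rewrite -dvdn2 (dvdn_trans _ n4).
  move=> _ /morphimP[x _ /(subsetP sB0)/cycleP[k ->] ->].
  have zkE := GLF_exp_scalar k zGE.
  exists (zeta ^+ k).
    apply/eqP; rewrite /= zkE (twist_scalar g1_lang) //.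
    by have := GLmx_fixed (zG ^+ k)%g; rewrite zkE [X in iter X _ _ = _]k1.
  have z4 : zeta ^+ n = 1.
    by apply/eqP; rewrite -(prim_order_dvd zeta_order) a_eq2 alpha0.
  by rewrite exprAC z4 expr1n.
- split=> //; have [_ _ _ defR] := radR.
  by rewrite (setIidPl triv).
exact: (wreath_special2 n_gt0 defW t_gt1 nz2 i2 Bj jE cl2 fixs radR).
Qed.
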